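(* Let $V$ be a countable transitive model of ZFC+CH, $M\in V$ an $\omega_1$-saturated non-standard model of true arithmetic of cardinality $\omega_1$, $\Omega\in M$ non-standard, and let $G$ be $V$-generic for $\mathcal{A}^+_{M,\Omega}$. Let $\mathrm{id}$ denote the random variable which is the identity on $\Omega$. Then: (i) $V[\mathrm{id}_G]=V[G]$; (ii) if $\mathcal{R}$ is a collection of random variables with $\mathrm{id}\in\mathcal{R}$, then $\mathrm{id}_G\in M[G]^{\mathcal{R}}$ and consequently $M[G]^{\mathcal{R}}\notin V$.
   Context: $\Omega$ is identified with $\{x\in M:x<\Omega\}$. $\mathcal{A}_{M,\Omega}$ is the set of subsets of $\Omega$ coded in $M$; $\mu_{M,\Omega}(A)=\mathrm{st}(|A|/|\Omega|)$ (standard part of the ratio of $M$-cardinalities); $\mathcal{A}^+_{M,\Omega}$ is the set of $A\in\mathcal{A}_{M,\Omega}$ of positive measure, preordered by $A\subseteq^*B$ iff $\mu_{M,\Omega}(A\setminus B)=0$. A random variable is a function $\alpha:\Omega\to M$ coded by an element of $M$. In $V[G]$, random variables are identified modulo $\alpha\equiv\beta$ iff $\{x\in\Omega:\alpha(x)=\beta(x)\}\in G$, and $\alpha_G$ denotes the class of $\alpha$ (among all random variables). For a collection $\mathcal{R}$ of random variables (closed under the functions of the language and containing the constant random variables), $M[G]^{\mathcal{R}}=\{\alpha_G:\alpha\in\mathcal{R}\}$, with functions and relations of the language interpreted pointwise modulo $G$ (a relation holds iff the set of $x$ where it holds pointwise in $M$ belongs to $G$). *)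

(* Defs.v *)
(** Sets are Aczel's well-founded trees modulo
    extensional equality, so that [=] on [set] is set-theoretic equality. *)
From Stdlib Require Import Reals List ClassicalEpsilon.
From Stdlib Require Import FunctionalExtensionality PropExtensionality.

Inductive ens : Type := Sup (A : Type) (f : A -> ens).

Fixpoint ens_eq (x y : ens) {struct x} : Prop :=
  match x, y with
  | Sup A f, Sup B g =>
      (forall a, exists b, ens_eq (f a) (g b)) /\
      (forall b, exists a, ens_eq (f a) (g b))
  end.

Lemma ens_eq_refl x : ens_eq x x.
Proof. induction x as [A f IH]; split; intros a; exists a; apply IH. Qed.

Lemma ens_eq_sym x y : ens_eq x y -> ens_eq y x.
Proof.
revert y; induction x as [A f IH]; intros [B g] [H1 H2]; split.
- intros b; destruct (H2 b) as [a Ha]; exists a; auto.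
- intros a; destruct (H1 a) as [b Hb]; exists b; auto.
Qed.

Lemma ens_eq_trans x y z : ens_eq x y -> ens_eq y z -> ens_eq x z.
Proof.
revert y z; induction x as [A f IH]; intros [B g] [C h] [H1 H2] [K1 K2]; split.
- intros a; destruct (H1 a) as [b Hb]; destruct (K1 b) as [c Hc].
  exists c; exact (IH a _ _ Hb Hc).
- intros c; destruct (K2 c) as [b Hb]; destruct (H2 b) as [a Ha].
  exists a; exact (IH a _ _ Ha Hb).
Qed.

Definition canon (x : ens) : ens := epsilon (inhabits x) (ens_eq x).

Lemma canonP x : ens_eq x (canon x).
Proof. unfold canon; apply epsilon_spec; exists x; apply ens_eq_refl. Qed.

Lemma canon_eq x y : ens_eq x y -> canon x = canon y.
Proof.
intros H; unfold canon.
replace (ens_eq x) with (ens_eq y).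
- apply epsilon_inh_irrelevance; exists y; apply ens_eq_refl.
- apply functional_extensionality; intros z; apply propositional_extensionality.
  split; apply ens_eq_trans; [exact H | apply ens_eq_sym, H].
Qed.

(** Leibniz quotient of [ens] by [ens_eq]. *)
Definition set : Type := { x : ens | canon x = x }.

Definition quo (x : ens) : set :=
  exist _ (canon x) (canon_eq _ _ (ens_eq_sym _ _ (canonP x))).

Definition idx (x : set) : Type := match proj1_sig x with Sup A _ => A end.

Definition elt (x : set) : idx x -> set :=
  match proj1_sig x as u return match u with Sup A _ => A end -> set with
  | Sup A f => fun i => quo (f i)
  end.

Definition mk (A : Type) (f : A -> set) : set :=
  quo (Sup A (fun a => proj1_sig (f a))).
Arguments mk {A} f.

Definition mem (y x : set) : Prop := exists i : idx x, elt x i = y.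

Declare Scope zf_scope.
Delimit Scope zf_scope with zf.
Infix "∈" := mem (at level 70) : zf_scope.
Notation "x ∉ y" := (~ mem x y) (at level 70) : zf_scope.
Open Scope zf_scope.

Lemma set_eq (x y : set) : ens_eq (proj1_sig x) (proj1_sig y) -> x = y.
Proof.
destruct x as [x Hx], y as [y Hy]; simpl; intros H.
assert (E : x = y) by (rewrite <- Hx, <- Hy; apply canon_eq, H).
subst y; f_equal; apply proof_irrelevance.
Qed.

Lemma mem_ens (y x : set) :
  y ∈ x <-> match proj1_sig x with Sup A f => exists a, ens_eq (proj1_sig y) (f a) end.
Proof.
unfold mem, idx, elt; destruct (proj1_sig x) as [A f]; split; intros [a Ha]; exists a.
- subst y; simpl; apply ens_eq_sym, canonP.
- symmetry; apply set_eq; simpl; eapply ens_eq_trans; [exact Ha | apply canonP].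
Qed.

Lemma mem_mk A (f : A -> set) y : y ∈ mk f <-> exists a, y = f a.
Proof.
rewrite mem_ens; unfold mk, quo; simpl.
pose proof (canonP (Sup A (fun a => proj1_sig (f a)))) as H.
destruct (canon _) as [B g]; destruct H as [H1 H2]; split.
- intros [b Hb]; destruct (H2 b) as [a Ha]; exists a; apply set_eq.
  eapply ens_eq_trans; [exact Hb | apply ens_eq_sym, Ha].
- intros [a ->]; exact (H1 a).
Qed.

Lemma set_ext (x y : set) : (forall z, z ∈ x <-> z ∈ y) -> x = y.
Proof.
intros H; apply set_eq.
assert (D : forall u v : set, (forall z, z ∈ u -> z ∈ v) ->
  match proj1_sig u, proj1_sig v with
  | Sup A f, Sup B g => forall a, exists b, ens_eq (f a) (g b) end).
{ intros u v K; pose proof (fun z => proj1 (mem_ens z v)) as Kv.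
  pose proof (fun z => proj2 (mem_ens z u)) as Ku.
  destruct (proj1_sig u) as [A f], (proj1_sig v) as [B g]; intros a.
  destruct (Kv (quo (f a))) as [b Hb].
  - apply K, Ku; exists a; simpl; apply ens_eq_sym, canonP.
  - exists b; eapply ens_eq_trans; [apply canonP | exact Hb]. }
pose proof (D x y (fun z => proj1 (H z))) as D1.
pose proof (D y x (fun z => proj2 (H z))) as D2.
destruct (proj1_sig x) as [A f], (proj1_sig y) as [B g]; split; [exact D1|].
intros b; destruct (D2 b) as [a Ha]; exists a; apply ens_eq_sym, Ha.
Qed.

Lemma mem_wf : well_founded mem.
Proof.
assert (H : forall e (x : set), ens_eq (proj1_sig x) e -> Acc mem x).
{ induction e as [A f IH]; intros x Hx; constructor; intros y Hy.
  apply mem_ens in Hy; destruct (proj1_sig x) as [B g].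
  destruct Hy as [b Hb], Hx as [H1 _]; destruct (H1 b) as [a Ha].
  apply (IH a); eapply ens_eq_trans; eassumption. }
intros x; apply (H (proj1_sig x)), ens_eq_refl.
Qed.

Definition subset (x y : set) : Prop := forall z, z ∈ x -> z ∈ y.
Infix "⊆" := subset (at level 70) : zf_scope.

Definition sep (P : set -> Prop) (x : set) : set :=
  mk (fun i : { i : idx x | P (elt x i) } => elt x (proj1_sig i)).
Definition image (F : set -> set) (x : set) : set :=
  mk (fun i : idx x => F (elt x i)).
Definition power (x : set) : set :=
  mk (fun P : idx x -> Prop => mk (fun i : { i | P i } => elt x (proj1_sig i))).
Definition empty : set := mk (fun e : Empty_set => match e with end).
Definition upair (x y : set) : set := mk (fun b : bool => if b then x else y).
Definition opair (x y : set) : set := upair (upair x x) (upair x y).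
Definition cprod (x y : set) : set :=
  mk (fun ij : idx x * idx y => opair (elt x (fst ij)) (elt y (snd ij))).
Definition setminus (x y : set) : set := sep (fun z => z ∉ y) x.
Definition succ (x : set) : set :=
  mk (fun i : option (idx x) => match i with Some j => elt x j | None => x end).

Lemma mem_sep P x z : z ∈ sep P x <-> z ∈ x /\ P z.
Proof.
unfold sep; rewrite mem_mk; split.
- intros [[i Hi] ->]; split; [exists i; reflexivity | exact Hi].
- intros [[i <-] Hi]; exists (exist _ i Hi); reflexivity.
Qed.

Lemma mem_image F x z : z ∈ image F x <-> exists y, y ∈ x /\ z = F y.
Proof.
unfold image; rewrite mem_mk; split.
- intros [i ->]; exists (elt x i); split; [exists i|]; reflexivity.
- intros [y [[i <-] ->]]; exists i; reflexivity.
Qed.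

Lemma mem_power x z : z ∈ power x <-> z ⊆ x.
Proof.
unfold power; rewrite mem_mk; split.
- intros [P ->] y Hy; apply mem_mk in Hy; destruct Hy as [[i Hi] ->].
  exists i; reflexivity.
- intros H; exists (fun i => elt x i ∈ z); apply set_ext; intros y.
  rewrite mem_mk; split.
  + intros Hy; destruct (H y Hy) as [i Hi]; subst y.
    exists (exist _ i Hy); reflexivity.
  + intros [[i Hi] ->]; exact Hi.
Qed.

Lemma mem_upair x y z : z ∈ upair x y <-> z = x \/ z = y.
Proof.
unfold upair; rewrite mem_mk; split.
- intros [[|] ->]; auto.
- intros [->| ->]; [exists true | exists false]; reflexivity.
Qed.

Lemma mem_cprod x y z :
  z ∈ cprod x y <-> exists a b, a ∈ x /\ b ∈ y /\ z = opair a b.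
Proof.
unfold cprod; rewrite mem_mk; split.
- intros [[i j] ->]; exists (elt x i), (elt y j).
  split; [exists i | split; [exists j|]]; reflexivity.
- intros [a [b [[i <-] [[j <-] ->]]]]; exists (i, j); reflexivity.
Qed.

Lemma mem_succ x z : z ∈ succ x <-> z ∈ x \/ z = x.
Proof.
unfold succ; rewrite mem_mk; split.
- intros [[i|] ->]; [left; exists i; reflexivity | right; reflexivity].
- intros [[i <-]| ->]; [exists (Some i) | exists None]; reflexivity.
Qed.

Fixpoint num (n : nat) : set :=
  match n with O => empty | S k => succ (num k) end.
Definition omega : set := mk num.

(** [ap f x] is f(x) when f is (the graph of) a function defined at x. *)
Definition ap (f x : set) : set :=
  epsilon (inhabits empty) (fun y => opair x y ∈ f).
Definition ap2 (f x y : set) : set := ap f (opair x y).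

Definition is_fun (f x y : set) : Prop :=
  f ⊆ cprod x y /\ forall a, a ∈ x -> exists! b, opair a b ∈ f.
Definition is_inj (f x y : set) : Prop :=
  is_fun f x y /\
  forall a b c, opair a c ∈ f -> opair b c ∈ f -> a = b.
Definition is_bij (f x y : set) : Prop :=
  is_inj f x y /\ forall b, b ∈ y -> exists a, opair a b ∈ f.

Definition scons {T : Type} (a : T) (e : nat -> T) (n : nat) : T :=
  match n with O => a | S k => e k end.

Definition transitive (x : set) : Prop := forall y, y ∈ x -> y ⊆ x.

(** Formulas of the language {∈}, variables as de Bruijn indices. *)
Inductive zform : Type :=
| zEq (i j : nat)
| zIn (i j : nat)
| zBot
| zImp (p q : zform)
| zAll (p : zform).

Fixpoint zsat (W : set) (e : nat -> set) (p : zform) : Prop :=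
  match p with
  | zEq i j => e i = e j
  | zIn i j => e i ∈ e j
  | zBot => False
  | zImp p q => zsat W e p -> zsat W e q
  | zAll p => forall a, a ∈ W -> zsat W (scons a e) p
  end.

(** W ⊨ ZFC: every axiom is relativized to W. *)
Record ZFC_model (W : set) : Prop := {
  zfc_extensionality : forall x y, x ∈ W -> y ∈ W ->
    (forall z, z ∈ W -> (z ∈ x <-> z ∈ y)) -> x = y;
  zfc_foundation : forall x, x ∈ W -> (exists y, y ∈ W /\ y ∈ x) ->
    exists y, y ∈ W /\ y ∈ x /\ ~ (exists z, z ∈ W /\ z ∈ y /\ z ∈ x);
  zfc_pairing : forall x y, x ∈ W -> y ∈ W ->
    exists p, p ∈ W /\ forall z, z ∈ W -> (z ∈ p <-> z = x \/ z = y);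
  zfc_union : forall x, x ∈ W ->
    exists u, u ∈ W /\
      forall z, z ∈ W -> (z ∈ u <-> exists y, y ∈ W /\ y ∈ x /\ z ∈ y);
  zfc_power : forall x, x ∈ W ->
    exists P, P ∈ W /\
      forall z, z ∈ W -> (z ∈ P <-> forall w, w ∈ W -> w ∈ z -> w ∈ x);
  zfc_infinity : exists x, x ∈ W /\
    (exists o, o ∈ W /\ o ∈ x /\ forall z, z ∈ W -> z ∉ o) /\
    (forall y, y ∈ W -> y ∈ x ->
       exists s, s ∈ W /\ s ∈ x /\
         forall z, z ∈ W -> (z ∈ s <-> z ∈ y \/ z = y));
  zfc_separation : forall (p : zform) (e : nat -> set) x,
    (forall n, e n ∈ W) -> x ∈ W ->
    exists y, y ∈ W /\
      forall z, z ∈ W -> (z ∈ y <-> z ∈ x /\ zsat W (scons z e) p);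
  zfc_replacement : forall (p : zform) (e : nat -> set) x,
    (forall n, e n ∈ W) -> x ∈ W ->
    (forall u, u ∈ W -> u ∈ x ->
       exists! v, v ∈ W /\ zsat W (scons u (scons v e)) p) ->
    exists y, y ∈ W /\
      forall v, v ∈ W ->
        (v ∈ y <->
         exists u, u ∈ W /\ u ∈ x /\ zsat W (scons u (scons v e)) p);
  zfc_choice : forall x, x ∈ W ->
    (forall y, y ∈ W -> y ∈ x -> exists z, z ∈ W /\ z ∈ y) ->
    (forall y y', y ∈ W -> y' ∈ W -> y ∈ x -> y' ∈ x ->
       (exists z, z ∈ W /\ z ∈ y /\ z ∈ y') -> y = y') ->
    exists c, c ∈ W /\
      forall y, y ∈ W -> y ∈ x -> exists! z, z ∈ W /\ z ∈ y /\ z ∈ c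
}.

Definition transitive_model (W : set) : Prop := transitive W /\ ZFC_model W.

Definition countable (x : set) : Prop :=
  exists e : nat -> set, forall y, y ∈ x -> exists n, e n = y.

Definition ctm (V : set) : Prop := transitive_model V /\ countable V.

(** Only the witnessing maps need relativizing: the other clauses are Δ₀, hence
    absolute for transitive V. *)
Definition countable_in (V x : set) : Prop :=
  exists f, f ∈ V /\ is_inj f x omega.
Definition equipotent_in (V x y : set) : Prop :=
  exists f, f ∈ V /\ is_bij f x y.
Definition ordinal (x : set) : Prop :=
  transitive x /\ forall y, y ∈ x -> transitive y.
Definition is_omega1_in (V k : set) : Prop :=
  k ∈ V /\ ordinal k /\ ~ countable_in V k /\
  forall a, a ∈ k -> countable_in V a.

Definition CH_in (V : set) : Prop :=
  exists k P, is_omega1_in V k /\ P ∈ V /\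
    (forall z, z ∈ P <-> z ∈ V /\ z ⊆ omega) /\ equipotent_in V P k.

(** V[x] is the smallest transitive model of ZFC that includes V and has x as
    an element; this one notion covers V[G] for generic G as well as V[id_G],
    where id_G is not a filter. *)
Definition extension (V x : set) (y : set) : Prop :=
  forall W, transitive_model W -> V ⊆ W -> x ∈ W -> y ∈ W.

Definition dense (P : set) (le : set -> set -> Prop) (D : set) : Prop :=
  D ⊆ P /\ forall p, p ∈ P -> exists q, q ∈ D /\ le q p.

Record generic (V P : set) (le : set -> set -> Prop) (G : set) : Prop := {
  gen_sub : G ⊆ P;
  gen_inhabited : exists p, p ∈ G;
  gen_up : forall p q, p ∈ G -> q ∈ P -> le p q -> q ∈ G;
  gen_directed : forall p q, p ∈ G -> q ∈ G ->
    exists r, r ∈ G /\ le r p /\ le r q;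
  gen_dense : forall D, D ∈ V -> dense P le D -> exists p, p ∈ G /\ p ∈ D
}.

Inductive term : Type :=
| tVar (i : nat)
| tZero
| tOne
| tAdd (s t : term)
| tMul (s t : term).

Inductive form : Type :=
| fEq (s t : term)
| fLt (s t : term)
| fBot
| fImp (p q : form)
| fAll (p : form).

Record structure : Type := {
  ty : Type;
  dom : ty -> Prop;
  s0 : ty;
  s1 : ty;
  sadd : ty -> ty -> ty;
  smul : ty -> ty -> ty;
  slt : ty -> ty -> Prop
}.

Fixpoint eval (S : structure) (e : nat -> ty S) (t : term) : ty S :=
  match t with
  | tVar i => e i
  | tZero => s0 S
  | tOne => s1 S
  | tAdd s t => sadd S (eval S e s) (eval S e t)
  | tMul s t => smul S (eval S e s) (eval S e t)
  end.

Fixpoint sat (S : structure) (e : nat -> ty S) (p : form) : Prop :=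
  match p with
  | fEq s t => eval S e s = eval S e t
  | fLt s t => slt S (eval S e s) (eval S e t)
  | fBot => False
  | fImp p q => sat S e p -> sat S e q
  | fAll p => forall a, dom S a -> sat S (scons a e) p
  end.

(** Truth of the universal closure. *)
Definition valid (S : structure) (p : form) : Prop :=
  forall e : nat -> ty S, (forall n, dom S (e n)) -> sat S e p.

Definition standard_model : structure :=
  {| ty := nat; dom := fun _ => True; s0 := 0; s1 := 1;
     sadd := Nat.add; smul := Nat.mul; slt := lt |}.

(** Hereditarily finite codes, so that a set of formulas can belong to V. *)
Fixpoint tcode (t : term) : set :=
  match t with
  | tVar i => opair (num 0) (num i)
  | tZero => opair (num 1) (num 0)
  | tOne => opair (num 1) (num 1)
  | tAdd s t => opair (num 2) (opair (tcode s) (tcode t))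
  | tMul s t => opair (num 3) (opair (tcode s) (tcode t))
  end.

Fixpoint fcode (p : form) : set :=
  match p with
  | fEq s t => opair (num 0) (opair (tcode s) (tcode t))
  | fLt s t => opair (num 1) (opair (tcode s) (tcode t))
  | fBot => opair (num 2) (num 0)
  | fImp p q => opair (num 3) (opair (fcode p) (fcode q))
  | fAll p => opair (num 4) (fcode p)
  end.

Record arith : Type := {
  car : set;
  zero : set;
  one : set;
  add : set;
  mul : set;
  lt_rel : set
}.

Definition arith_set (M : arith) : set :=
  opair (car M) (opair (zero M) (opair (one M)
    (opair (add M) (opair (mul M) (lt_rel M))))).

Definition is_arith (M : arith) : Prop :=
  zero M ∈ car M /\ one M ∈ car M /\
  is_fun (add M) (cprod (car M) (car M)) (car M) /\
  is_fun (mul M) (cprod (car M) (car M)) (car M) /\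
  lt_rel M ⊆ cprod (car M) (car M).

Definition plus (M : arith) (x y : set) : set := ap2 (add M) x y.
Definition times (M : arith) (x y : set) : set := ap2 (mul M) x y.
Definition less (M : arith) (x y : set) : Prop := opair x y ∈ lt_rel M.
Definition leq (M : arith) (x y : set) : Prop := less M x y \/ x = y.

Definition arith_structure (M : arith) : structure :=
  {| ty := set; dom := fun x => x ∈ car M; s0 := zero M; s1 := one M;
     sadd := plus M; smul := times M; slt := less M |}.

Definition true_arithmetic (M : arith) : Prop :=
  is_arith M /\
  forall p, valid standard_model p -> valid (arith_structure M) p.

Fixpoint nmul (M : arith) (n : nat) (x : set) : set :=
  match n with O => zero M | S k => plus M (nmul M k x) x end.

Definition nonstandard (M : arith) (a : set) : Prop :=
  a ∈ car M /\ forall n, less M (nmul M n (one M)) a.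

Definition nonstandard_model (M : arith) : Prop := exists a, nonstandard M a.

(** ω₁-saturation in the sense of V.  The sequence [s] lists countably many
    parameters; [p] is a type in variable 0, variable i+1 denoting s(i). *)
Definition omega1_saturated_in (V : set) (M : arith) : Prop :=
  forall s p, s ∈ V -> p ∈ V -> is_fun s omega (car M) ->
    (forall l : list form, (forall q, In q l -> fcode q ∈ p) ->
       exists a, a ∈ car M /\ forall q, In q l ->
         sat (arith_structure M) (scons a (fun i => ap s (num i))) q) ->
    exists a, a ∈ car M /\ forall q, fcode q ∈ p ->
      sat (arith_structure M) (scons a (fun i => ap s (num i))) q.

Definition card_omega1_in (V : set) (M : arith) : Prop :=
  exists k, is_omega1_in V k /\ equipotent_in V (car M) k.

Definition seg (M : arith) (n : set) : set := sep (fun x => less M x n) (car M).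

(** Gödel's β function: β(a,b,x) is the remainder of a modulo 1 + (x+1)b.
    An element of M codes, through the pairing function, a pair (a,b). *)
Definition beta_modulus (M : arith) (b x : set) : set :=
  plus M (one M) (times M (plus M x (one M)) b).
Definition beta (M : arith) (a b x y : set) : Prop :=
  less M y (beta_modulus M b x) /\
  exists q, q ∈ car M /\ a = plus M (times M q (beta_modulus M b x)) y.

Definition coded_fun (M : arith) (n f : set) : Prop :=
  is_fun f (seg M n) (car M) /\
  exists a b, a ∈ car M /\ b ∈ car M /\
    forall x, x ∈ seg M n -> beta M a b x (ap f x).

Definition coded_set (M : arith) (n A : set) : Prop :=
  A ⊆ seg M n /\
  exists a b, a ∈ car M /\ b ∈ car M /\
    forall x, x ∈ seg M n -> (x ∈ A <-> beta M a b x (zero M)).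

(** The bijection must be coded in M, so this is cardinality in the sense of M. *)
Definition mcard (M : arith) (A n : set) : Prop :=
  n ∈ car M /\ exists f, coded_fun M n f /\ is_bij f (seg M n) A.

(** r = st(a/w): standard fractions p/q below (above) r are ≤ (≥) a/w in M. *)
Definition is_st (M : arith) (a w : set) (r : R) : Prop :=
  (0 <= r)%R /\
  forall p q : nat, 0 < q ->
    ((INR p / INR q < r)%R -> leq M (nmul M p w) (nmul M q a)) /\
    ((r < INR p / INR q)%R -> leq M (nmul M q a) (nmul M p w)).

Definition is_mu (M : arith) (Om A : set) (r : R) : Prop :=
  exists a w, mcard M A a /\ mcard M (seg M Om) w /\ is_st M a w r.

Definition Acal (M : arith) (Om : set) : set :=
  sep (coded_set M Om) (power (seg M Om)).
Definition Aplus (M : arith) (Om : set) : set :=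
  sep (fun A => exists r, is_mu M Om A r /\ (0 < r)%R) (Acal M Om).
Definition le_star (M : arith) (Om A B : set) : Prop :=
  is_mu M Om (setminus A B) 0%R.

Definition RV (M : arith) (Om : set) : set :=
  sep (coded_fun M Om) (power (cprod (seg M Om) (car M))).

Definition id_rv (M : arith) (Om : set) : set :=
  image (fun x => opair x x) (seg M Om).
Definition const_rv (M : arith) (Om c : set) : set :=
  image (fun x => opair x c) (seg M Om).
Definition pointwise (M : arith) (Om : set) (op : set -> set -> set)
    (f g : set) : set :=
  image (fun x => opair x (op (ap f x) (ap g x))) (seg M Om).

(** α_G for α = f, taken among all random variables rather than inside a family. *)
Definition rv_class (M : arith) (Om G f : set) : set :=
  sep (fun g => sep (fun x => ap f x = ap g x) (seg M Om) ∈ G) (RV M Om).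

Record rv_collection (M : arith) (Om F : set) : Prop := {
  rvc_sub : F ⊆ RV M Om;
  rvc_const : forall c, c ∈ car M -> const_rv M Om c ∈ F;
  rvc_add : forall f g, f ∈ F -> g ∈ F -> pointwise M Om (plus M) f g ∈ F;
  rvc_mul : forall f g, f ∈ F -> g ∈ F -> pointwise M Om (times M) f g ∈ F
}.

Definition rv_carrier (M : arith) (Om G F : set) : set :=
  image (rv_class M Om G) F.
Definition rv_op (M : arith) (Om G F : set) (op : set -> set -> set) : set :=
  let C := rv_carrier M Om G F in
  sep (fun u => exists f g, f ∈ F /\ g ∈ F /\
         u = opair (opair (rv_class M Om G f) (rv_class M Om G g))
                   (rv_class M Om G (pointwise M Om op f g)))
      (cprod (cprod C C) C).
Definition rv_lt (M : arith) (Om G F : set) : set :=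
  let C := rv_carrier M Om G F in
  sep (fun u => exists f g, f ∈ F /\ g ∈ F /\
         u = opair (rv_class M Om G f) (rv_class M Om G g) /\
         sep (fun x => less M (ap f x) (ap g x)) (seg M Om) ∈ G)
      (cprod C C).

(** The structure M[G]^F for a family F of random variables. *)
Definition rv_model (M : arith) (Om G F : set) : arith :=
  {| car := rv_carrier M Om G F;
     zero := rv_class M Om G (const_rv M Om (zero M));
     one := rv_class M Om G (const_rv M Om (one M));
     add := rv_op M Om G F (plus M);
     mul := rv_op M Om G F (times M);
     lt_rel := rv_lt M Om G F |}.

(* Main.v *)
(** A set is in [G] iff it is the set of fixed points of some random variable
    equivalent to [id]: by Gödel's β-function lemma every coded set is the set of
    fixed points of a coded function.  Thus [G] and the class of [id] are
    interdefinable over [V], and a transitive model of ZFC that includes [V] contains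
    one iff it contains the other.

    [G] is not in [V]: the coded sets of positive measure form a set of [V], and each of
    them splits into two disjoint ones of about half its cardinality.  At most one of
    the two is in [G], so the complement of [G] is dense.  If [M[G]^F] were in [V], so
    would be its element, the class of [id], and therefore [G].

    Statements about coded objects of [M] are true in the standard model, where they
    become finite combinatorics, and transfer to [M] because they are first-order. *)
From Stdlib Require Import Reals List Arith Lia Lra ClassicalEpsilon.
From Stdlib Require Import FunctionalExtensionality.
Require Import Defs.

(** Genericity applies to the complement of [G] only if that complement is an element of [V], and
    there lies the obstacle: [Aplus] is defined through real and natural numbers of the metatheory,
    which no ∈-formula mentions. Positivity of measure is therefore rewritten as [Om] ≤ n·a for some
    standard n, where a is the cardinality of the set in [M]; the quantifier over n is then replaced
    by one over derivations that are elements of [V].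

    Two sorts of definability are needed. Formulas of arithmetic, uniform in the structure, carry
    combinatorial facts from the standard model to [M]; ∈-formulas with parameters, relativized to a
    transitive model, show by separation that a set belongs to it. Cardinality in [M] is expressed
    by coded enumerations, which become lists in the standard model.

    The non-standardness of [Om] enters in the halving: a set of positive measure must have more
    than one element for each half to keep positive measure. *)

(** * The Chinese remainder theorem and Gödel's β-function lemma *)

Lemma coprime_intro n m :
  (forall d, Nat.divide d n -> Nat.divide d m -> Nat.divide d 1) -> Nat.gcd n m = 1.
Proof.
intros H; apply Nat.divide_1_r, H; [apply Nat.gcd_divide_l | apply Nat.gcd_divide_r].
Qed.

Lemma coprime_elim n m d :
  Nat.gcd n m = 1 -> Nat.divide d n -> Nat.divide d m -> Nat.divide d 1.
Proof. intros <-; apply Nat.gcd_greatest. Qed.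

Lemma coprime_mul_l n m x :
  Nat.gcd n x = 1 -> Nat.gcd m x = 1 -> Nat.gcd (n * m) x = 1.
Proof.
intros Hn Hm; apply coprime_intro; intros d Hd Hx.
apply (coprime_elim m x); auto.
apply (Nat.gauss d n m); [assumption|].
apply coprime_intro; intros e He He'; apply (coprime_elim n x); auto.
exact (Nat.divide_trans _ _ _ He Hx).
Qed.

Lemma chinese_remainder (m f : nat -> nat) (k : nat) :
  (forall i j, i < j < k -> Nat.gcd (m i) (m j) = 1) ->
  (forall i, i < k -> f i < m i) ->
  exists a, forall i, i < k -> a mod m i = f i.
Proof.
intros Hm Hf.
(* P stands for the product of the moduli. The induction carries what it uses of it: P is a common
   multiple, it is coprime to whatever is coprime to every modulus, and it is positive, which gives
   Bézout's identity in the form u P = 1 + v m_k. *)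
enough (H : exists a P, 0 < P /\ (forall i, i < k -> a mod m i = f i) /\
  (forall i, i < k -> Nat.divide (m i) P) /\
  (forall x, (forall i, i < k -> Nat.gcd (m i) x = 1) -> Nat.gcd P x = 1)).
{ destruct H as [a [_ [_ [H _]]]]; exists a; exact H. }
induction k as [|k IH].
- exists 0, 1; repeat split; intros; lia.
- destruct IH as [a [P [P0 [Ha [HP Hc]]]]].
  { intros i j Hij; apply Hm; lia. }
  { intros i Hi; apply Hf; lia. }
  assert (C : Nat.gcd P (m k) = 1) by (apply Hc; intros i Hi; apply Hm; lia).
  assert (Hk : f k < m k) by (apply Hf; lia).
  destruct (Nat.gcd_bezout_pos P (m k) P0) as [u [v E]]; rewrite C in E.
  (* Modulo m_k, u P is 1 and f k + a (m_k - 1) is f k - a, written without subtraction of a. The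
     added term is a multiple of P, so the earlier residues do not change. *)
  exists (a + u * (f k + a * (m k - 1)) * P), (P * m k); repeat split.
  + nia.
  + intros i Hi; destruct (Nat.eq_dec i k) as [->|Hik].
    * replace (a + u * (f k + a * (m k - 1)) * P)
        with (f k + (a + v * (f k + a * (m k - 1))) * m k).
      { rewrite Nat.Div0.mod_add; apply Nat.mod_small, Hk. }
      replace (u * (f k + a * (m k - 1)) * P)
        with (u * P * (f k + a * (m k - 1))) by ring.
      rewrite E; nia.
    * destruct (HP i) as [c ->]; [lia|].
      rewrite Nat.mul_assoc, Nat.Div0.mod_add; apply Ha; lia.
  + intros i Hi; destruct (Nat.eq_dec i k) as [->|Hik].
    * apply Nat.divide_factor_r.
    * apply Nat.divide_mul_l, HP; lia.
  + intros x Hx; apply coprime_mul_l; [apply Hc; intros i Hi|]; apply Hx; lia.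
Qed.

Lemma sequence_bounded (f : nat -> nat) n : exists b, forall x, x < n -> f x < b.
Proof.
induction n as [|n [b Hb]].
- exists 0; lia.
- exists (b + S (f n)); intros x Hx; destruct (Nat.eq_dec x n) as [->|]; [lia|].
  specialize (Hb x ltac:(lia)); lia.
Qed.

Lemma divide_fact d n : 0 < d <= n -> Nat.divide d (fact n).
Proof.
induction n as [|n IH]; intros H; [lia|].
change (fact (S n)) with (S n * fact n).
destruct (Nat.eq_dec d (S n)) as [->|].
- apply Nat.divide_factor_l.
- apply Nat.divide_mul_r, IH; lia.
Qed.

(** Take b = (c + n)! where c bounds the values: c makes each modulus exceed its value, and n makes
    b divisible by every difference of two distinct indices, whence the moduli are pairwise
    coprime. *)
Lemma goedel_beta (f : nat -> nat) n :
  exists a b, forall x, x < n -> a mod (1 + (x + 1) * b) = f x.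
Proof.
destruct (sequence_bounded f n) as [c Hc].
assert (Hb : c + n <= fact (c + n)).
{ generalize (c + n); intros k; induction k as [|k IH]; [lia|].
  change (fact (S k)) with (S k * fact k); pose proof (lt_O_fact k); nia. }
destruct (chinese_remainder (fun x => 1 + (x + 1) * fact (c + n)) f n) as [a Ha].
- (* A common divisor of two moduli divides [(j + 1) m_i - (i + 1) m_j = j - i],
     hence [(c + n)!], hence 1. *)
  intros i j Hij; apply coprime_intro; intros d Hi Hj.
  assert (D : Nat.divide d (j - i)).
  { replace (j - i) with
      ((j + 1) * (1 + (i + 1) * fact (c + n)) - (i + 1) * (1 + (j + 1) * fact (c + n)))
      by nia.
    apply Nat.divide_sub_r; apply Nat.divide_mul_r; assumption. }
  assert (F : Nat.divide d (fact (c + n))).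
  { eapply Nat.divide_trans; [exact D|]; apply divide_fact; lia. }
  replace 1 with ((1 + (i + 1) * fact (c + n)) - (i + 1) * fact (c + n)) by lia.
  apply Nat.divide_sub_r; [exact Hi|]; apply Nat.divide_mul_r, F.
- intros i Hi; specialize (Hc i Hi); nia.
- exists a, (fact (c + n)); exact Ha.
Qed.

(** * First-order definability and transfer from the standard model *)

(** A property of structures is stated uniformly in the structure [T], so that its
    instance at [arith_structure M] is convertible to the notions about [M]. *)
Definition fo_definable (P : forall T, (nat -> ty T) -> Prop) : Prop :=
  exists p, forall T e, (forall n, dom T (e n)) -> (sat T e p <-> P T e).

Definition fo_term (t : forall T, (nat -> ty T) -> ty T) : Prop :=
  exists u, forall T e, eval T e u = t T e.

Lemma fo_var i : fo_term (fun T e => e i).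
Proof. exists (tVar i); reflexivity. Qed.

Lemma fo_zero : fo_term (fun T e => s0 T).
Proof. exists tZero; reflexivity. Qed.

Lemma fo_one : fo_term (fun T e => s1 T).
Proof. exists tOne; reflexivity. Qed.

Lemma fo_add s t :
  fo_term s -> fo_term t -> fo_term (fun T e => sadd T (s T e) (t T e)).
Proof.
intros [u Hu] [v Hv]; exists (tAdd u v); intros T e; simpl; rewrite Hu, Hv; reflexivity.
Qed.

Lemma fo_mul s t :
  fo_term s -> fo_term t -> fo_term (fun T e => smul T (s T e) (t T e)).
Proof.
intros [u Hu] [v Hv]; exists (tMul u v); intros T e; simpl; rewrite Hu, Hv; reflexivity.
Qed.

Lemma fo_eq s t : fo_term s -> fo_term t -> fo_definable (fun T e => s T e = t T e).
Proof.
intros [u Hu] [v Hv]; exists (fEq u v); intros T e _; simpl; rewrite Hu, Hv; tauto.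
Qed.

Lemma fo_lt s t : fo_term s -> fo_term t -> fo_definable (fun T e => slt T (s T e) (t T e)).
Proof.
intros [u Hu] [v Hv]; exists (fLt u v); intros T e _; simpl; rewrite Hu, Hv; tauto.
Qed.

Lemma fo_False : fo_definable (fun T e => False).
Proof. exists fBot; reflexivity. Qed.

Lemma fo_imp P Q :
  fo_definable P -> fo_definable Q -> fo_definable (fun T e => P T e -> Q T e).
Proof.
intros [p Hp] [q Hq]; exists (fImp p q); intros T e He; simpl.
rewrite (Hp T e He), (Hq T e He); tauto.
Qed.

Lemma fo_all (R : forall T, (nat -> ty T) -> ty T -> Prop) :
  fo_definable (fun T e => R T (fun n => e (S n)) (e 0)) ->
  fo_definable (fun T e => forall x, dom T x -> R T e x).
Proof.
intros [p Hp]; exists (fAll p); intros T e He; simpl.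
split; intros H x Hx; specialize (H x Hx);
  apply (Hp T (scons x e)); auto; intros [|n]; simpl; auto.
Qed.

(** Disjunction, conjunction and existence, which [form] lacks, are reduced classically to
    implication, falsity and universal quantification through this lemma. *)
Lemma fo_ext P Q :
  (forall T e, P T e <-> Q T e) -> fo_definable P -> fo_definable Q.
Proof.
intros H [p Hp]; exists p; intros T e He; rewrite (Hp T e He); apply H.
Qed.

Lemma fo_not P : fo_definable P -> fo_definable (fun T e => ~ P T e).
Proof. intros H; exact (fo_imp _ _ H fo_False). Qed.

Lemma fo_or P Q :
  fo_definable P -> fo_definable Q -> fo_definable (fun T e => P T e \/ Q T e).
Proof.
intros HP HQ; eapply fo_ext; [|exact (fo_imp _ _ (fo_not _ HP) HQ)].
intros T e; simpl; tauto.
Qed.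

Lemma fo_and P Q :
  fo_definable P -> fo_definable Q -> fo_definable (fun T e => P T e /\ Q T e).
Proof.
intros HP HQ; eapply fo_ext; [|exact (fo_not _ (fo_imp _ _ HP (fo_not _ HQ)))].
intros T e; simpl; tauto.
Qed.

Lemma fo_ex (R : forall T, (nat -> ty T) -> ty T -> Prop) :
  fo_definable (fun T e => R T (fun n => e (S n)) (e 0)) ->
  fo_definable (fun T e => exists x, dom T x /\ R T e x).
Proof.
intros H; eapply fo_ext;
  [|exact (fo_not _ (fo_all (fun T e x => ~ R T e x) (fo_not _ H)))].
intros T e; simpl; split.
- intros K; apply NNPP; intros N; apply K; intros x Hx Hr; apply N; eauto.
- intros [x [Hx Hr]] K; exact (K x Hx Hr).
Qed.

(** The multiplier is a natural number of the metatheory, so each n gives its own term, and facts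
    about standard multiples are transferred for one multiplier at a time. *)
Fixpoint snmul (T : structure) (n : nat) (x : ty T) : ty T :=
  match n with O => s0 T | S k => sadd T (snmul T k x) x end.

Lemma fo_nmul n t : fo_term t -> fo_term (fun T e => snmul T n (t T e)).
Proof.
intros Ht; induction n as [|n IH]; simpl; [apply fo_zero | apply fo_add; assumption].
Qed.

Ltac fo_tac := cbv beta; lazymatch goal with
  | |- fo_term (fun T e => e _) => apply fo_var
  | |- fo_term (fun T e => s0 T) => apply fo_zero
  | |- fo_term (fun T e => s1 T) => apply fo_one
  | |- fo_term (fun T e => sadd T _ _) => apply fo_add; fo_tac
  | |- fo_term (fun T e => smul T _ _) => apply fo_mul; fo_tac
  | |- fo_term (fun T e => snmul T _ _) => apply fo_nmul; fo_tac
  | |- fo_definable (fun T e => False) => apply fo_False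
  | |- fo_definable (fun T e => _ /\ _) => apply fo_and; fo_tac
  | |- fo_definable (fun T e => _ \/ _) => apply fo_or; fo_tac
  | |- fo_definable (fun T e => ~ _) => apply fo_not; fo_tac
  | |- fo_definable (fun T e => _ = _) => apply fo_eq; fo_tac
  | |- fo_definable (fun T e => slt T _ _) => apply fo_lt; fo_tac
  | |- fo_definable (fun T e => exists x, _) => apply fo_ex; fo_tac
  | |- fo_definable _ => first [apply fo_imp | apply fo_all]; fo_tac
  end.

(** Parameters from [M] are generalized before this is applied, so that [P] speaks of the structure
    alone. The truth of its formula then does not depend on the assignment, and the constant
    assignment [zero M] is as good as any. *)
Lemma transfer (P : structure -> Prop) (M : arith) :
  fo_definable (fun T _ => P T) -> true_arithmetic M ->
  P standard_model -> P (arith_structure M).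
Proof.
intros [p Hp] [[Hz _] HM] HP.
apply (Hp (arith_structure M) (fun _ => zero M)); [intros; exact Hz|].
apply HM; [|intros; exact Hz].
intros e He; apply Hp; assumption.
Qed.

(** * Sequences coded by the β function, read in the standard model as lists *)

Definition smodulus (T : structure) (b x : ty T) : ty T :=
  sadd T (s1 T) (smul T (sadd T x (s1 T)) b).

Definition sbeta (T : structure) (a b x y : ty T) : Prop :=
  slt T y (smodulus T b x) /\
  exists q, dom T q /\ a = sadd T (smul T q (smodulus T b x)) y.

Definition srange (T : structure) (c d m y : ty T) : Prop :=
  exists x, dom T x /\ slt T x m /\ sbeta T c d x y.

(** Every quantifier is followed directly by its bound, the form that [fo_all] accepts. *)
Definition sinjective (T : structure) (c d m : ty T) : Prop :=
  forall x, dom T x -> forall x', dom T x' -> forall y, dom T y ->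
  slt T x m -> slt T x' m -> sbeta T c d x y -> sbeta T c d x' y -> x = x'.

Lemma sbeta_nat a b x y :
  sbeta standard_model a b x y <-> y = a mod (1 + (x + 1) * b).
Proof.
unfold sbeta, smodulus; cbn -[Nat.modulo Nat.add Nat.mul]; split.
- intros [H [q [_ ->]]]; symmetry; rewrite Nat.add_comm, Nat.Div0.mod_add.
  apply Nat.mod_small, H.
- intros ->; split; [apply Nat.mod_upper_bound; lia|].
  exists (a / (1 + (x + 1) * b)); split; [exact I|].
  rewrite (Nat.div_mod_eq a (1 + (x + 1) * b)) at 1; lia.
Qed.

(** Together with [srange_nat], this allows cardinalities in the standard model to be compared by
    lengths of lists. *)
Lemma sinjective_nat c d m : sinjective standard_model c d m <->
  NoDup (map (fun x => c mod (1 + (x + 1) * d)) (seq 0 m)).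
Proof.
unfold sinjective; setoid_rewrite sbeta_nat; cbn -[Nat.modulo Nat.add Nat.mul]; split.
- intros H; apply NoDup_map_NoDup_ForallPairs; [|apply seq_NoDup].
  intros x x' Hx Hx' E; apply in_seq in Hx, Hx'.
  apply (H x I x' I _ I) with (3 := eq_refl); auto; lia.
- intros H x _ x' _ y _ Hx Hx' -> E.
  revert H; set (l := map _ _); intros H.
  assert (G : forall z, z < m -> nth_error l z = Some (c mod (1 + (z + 1) * d))).
  { intros z Hz; unfold l; rewrite nth_error_map.
    rewrite nth_error_nth' with (d := 0) by (rewrite length_seq; exact Hz).
    rewrite seq_nth by exact Hz; reflexivity. }
  apply (proj1 (NoDup_nth_error l) H).
  + unfold l; rewrite length_map, length_seq; exact Hx.
  + rewrite !G by assumption; congruence.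
Qed.

Lemma srange_nat c d m y : srange standard_model c d m y <->
  In y (map (fun x => c mod (1 + (x + 1) * d)) (seq 0 m)).
Proof.
unfold srange; setoid_rewrite sbeta_nat; cbn -[Nat.modulo Nat.add Nat.mul].
rewrite in_map_iff; setoid_rewrite in_seq; split.
- intros [x [_ [Hx ->]]]; exists x; split; [reflexivity | lia].
- intros [x [<- Hx]]; exists x; repeat split; lia.
Qed.

(** * Ordered pairs, functions and the operations of [M] *)

Lemma opair_inj a b c d : opair a b = opair c d -> a = c /\ b = d.
Proof.
intros E.
assert (H : forall z, z ∈ opair a b <-> z ∈ opair c d) by (rewrite E; tauto).
assert (S : forall x y z, upair x x = upair y z -> x = y /\ x = z).
{ intros x y z F; assert (K : forall w, w ∈ upair x x <-> w ∈ upair y z)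
    by (rewrite F; tauto).
  setoid_rewrite mem_upair in K; pose proof (proj2 (K y)); pose proof (proj2 (K z)).
  intuition. }
assert (U : forall x y z, upair x y = upair x z -> y = z).
{ intros x y z F; assert (K : forall w, w ∈ upair x y <-> w ∈ upair x z)
    by (rewrite F; tauto).
  setoid_rewrite mem_upair in K; pose proof (proj1 (K y)); pose proof (proj2 (K z)).
  intuition congruence. }
unfold opair in H; setoid_rewrite mem_upair in H.
assert (A : a = c).
{ destruct (proj1 (H (upair a a)) (or_introl eq_refl)) as [F|F]; apply S in F; tauto. }
subst c; split; [reflexivity|].
destruct (proj1 (H (upair a b)) (or_intror eq_refl)) as [F|F]; [|exact (U _ _ _ F)].
destruct (proj2 (H (upair a d)) (or_intror eq_refl)) as [K|K]; [|symmetry; exact (U _ _ _ K)].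
apply U in F; apply U in K; congruence.
Qed.

Lemma opair_cprod a b x y : opair a b ∈ cprod x y <-> a ∈ x /\ b ∈ y.
Proof.
rewrite mem_cprod; split.
- intros [c [d [Hc [Hd E]]]]; apply opair_inj in E as [-> ->]; auto.
- intros [Ha Hb]; exists a, b; auto.
Qed.

Lemma is_fun_dom f x y a b : is_fun f x y -> opair a b ∈ f -> a ∈ x /\ b ∈ y.
Proof. intros [Hf _] H; apply opair_cprod, Hf, H. Qed.

Lemma opair_ap f x y a : is_fun f x y -> a ∈ x -> opair a (ap f a) ∈ f.
Proof.
intros [_ Hf] Ha; destruct (Hf a Ha) as [b [Hb _]].
unfold ap; apply epsilon_spec; exists b; exact Hb.
Qed.

Lemma ap_in f x y a : is_fun f x y -> a ∈ x -> ap f a ∈ y.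
Proof. intros Hf Ha; eapply is_fun_dom; [exact Hf | eapply opair_ap; eassumption]. Qed.

Lemma ap_eq f x y a b : is_fun f x y -> opair a b ∈ f -> ap f a = b.
Proof.
intros Hf Hb; destruct (is_fun_dom _ _ _ _ _ Hf Hb) as [Ha _].
pose proof (opair_ap _ _ _ _ Hf Ha) as Hc.
destruct Hf as [_ Hf]; destruct (Hf a Ha) as [d [_ Hd]].
rewrite <- (Hd _ Hb); symmetry; apply Hd, Hc.
Qed.

Lemma mem_seg M n x : x ∈ seg M n <-> x ∈ car M /\ less M x n.
Proof. exact (mem_sep _ _ _). Qed.

Lemma mem_setminus x y z : z ∈ setminus x y <-> z ∈ x /\ z ∉ y.
Proof. exact (mem_sep _ _ _). Qed.

Lemma mem_empty z : z ∉ empty.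
Proof. unfold empty; rewrite mem_mk; intros [[] _]. Qed.

Lemma less_car M x y : is_arith M -> less M x y -> x ∈ car M /\ y ∈ car M.
Proof. intros [_ [_ [_ [_ H]]]] L; apply opair_cprod, H, L. Qed.

Lemma add_graph M x y z : is_arith M ->
  opair (opair x y) z ∈ add M <-> x ∈ car M /\ y ∈ car M /\ plus M x y = z.
Proof.
intros [_ [_ [H _]]]; split.
- intros K; destruct (is_fun_dom _ _ _ _ _ H K) as [A _].
  apply opair_cprod in A as [Hx Hy]; repeat split; auto; eapply ap_eq; eassumption.
- intros [Hx [Hy <-]]; eapply opair_ap; [exact H | apply opair_cprod; auto].
Qed.

Lemma mul_graph M x y z : is_arith M ->
  opair (opair x y) z ∈ mul M <-> x ∈ car M /\ y ∈ car M /\ times M x y = z.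
Proof.
intros [_ [_ [_ [H _]]]]; split.
- intros K; destruct (is_fun_dom _ _ _ _ _ H K) as [A _].
  apply opair_cprod in A as [Hx Hy]; repeat split; auto; eapply ap_eq; eassumption.
- intros [Hx [Hy <-]]; eapply opair_ap; [exact H | apply opair_cprod; auto].
Qed.

Lemma plus_car M x y : is_arith M -> x ∈ car M -> y ∈ car M -> plus M x y ∈ car M.
Proof. intros [_ [_ [H _]]] Hx Hy; eapply ap_in; [exact H | apply opair_cprod; auto]. Qed.

Lemma times_car M x y : is_arith M -> x ∈ car M -> y ∈ car M -> times M x y ∈ car M.
Proof. intros [_ [_ [_ [H _]]]] Hx Hy; eapply ap_in; [exact H | apply opair_cprod; auto]. Qed.

Lemma nmul_car M n x : is_arith M -> x ∈ car M -> nmul M n x ∈ car M.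
Proof.
intros H Hx; induction n as [|n IH]; simpl; [apply H | apply plus_car; assumption].
Qed.

(** ** Consequences of true arithmetic *)

(** Keeps conversion from unfolding these while it compares a notion about [M]
    with the generic notion at [arith_structure M]. *)
Strategy 100 [mem plus times less ap2 ap].

Lemma snmul_nat n (x : nat) : snmul standard_model n x = n * x.
Proof. induction n as [|n IH]; cbn; [reflexivity|]; cbn in IH; rewrite IH; lia. Qed.

Lemma snmul_nmul M n x : snmul (arith_structure M) n x = nmul M n x.
Proof. induction n as [|n IH]; simpl; [reflexivity|]; rewrite IH; reflexivity. Qed.

Lemma less_trichotomy M x y : true_arithmetic M -> x ∈ car M -> y ∈ car M ->
  less M x y \/ x = y \/ less M y x.
Proof.
intros HM Hx Hy; revert x Hx y Hy.
refine (transfer (fun T => forall x, dom T x -> forall y, dom T y ->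
  slt T x y \/ x = y \/ slt T y x) M _ HM _);
  [fo_tac|].
cbn; intros; lia.
Qed.

Lemma less_asym M x y : true_arithmetic M -> less M x y -> ~ leq M y x.
Proof.
intros HM H; destruct (less_car _ _ _ (proj1 HM) H) as [Hx Hy]; revert x Hx y Hy H.
refine (transfer (fun T => forall x, dom T x -> forall y, dom T y -> slt T x y ->
  ~ (slt T y x \/ y = x)) M _ HM _);
  [fo_tac|].
cbn; intros; lia.
Qed.

Lemma not_less_zero M x : true_arithmetic M -> ~ less M x (zero M).
Proof.
intros HM H; destruct (less_car _ _ _ (proj1 HM) H) as [Hx _]; revert x Hx H.
refine (transfer (fun T => forall x, dom T x -> ~ slt T x (s0 T)) M _ HM _);
  [fo_tac|].
cbn; intros; lia.
Qed.

Lemma leq_iff M x y : true_arithmetic M -> x ∈ car M -> y ∈ car M ->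
  leq M x y <-> ~ less M y x.
Proof.
intros HM Hx Hy; split.
- intros H K; exact (less_asym _ _ _ HM K H).
- destruct (less_trichotomy M x y HM Hx Hy) as [|[|]]; unfold leq; tauto.
Qed.

Lemma zero_leq M x : true_arithmetic M -> x ∈ car M -> leq M (zero M) x.
Proof.
intros HM Hx; apply leq_iff; [assumption | apply HM | assumption |].
apply not_less_zero, HM.
Qed.

Lemma leq_antisym M x y : true_arithmetic M -> x ∈ car M -> y ∈ car M ->
  leq M x y -> leq M y x -> x = y.
Proof.
intros HM Hx Hy [H|H] K; [|exact H]; exfalso; exact (less_asym _ _ _ HM H K).
Qed.

Lemma plus_zero M x : true_arithmetic M -> x ∈ car M -> plus M x (zero M) = x.
Proof.
intros HM; revert x.
refine (transfer (fun T => forall x, dom T x -> sadd T x (s0 T) = x) M _ HM _);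
  [fo_tac|].
cbn; intros; lia.
Qed.

Lemma plus_one_neq M x : true_arithmetic M -> x ∈ car M -> plus M x (one M) <> x.
Proof.
intros HM; revert x.
refine (transfer (fun T => forall x, dom T x -> sadd T x (s1 T) <> x) M _ HM _);
  [fo_tac|].
cbn; intros; lia.
Qed.

Lemma beta_unique M a b x y z : true_arithmetic M ->
  a ∈ car M -> b ∈ car M -> x ∈ car M -> y ∈ car M -> z ∈ car M ->
  beta M a b x y -> beta M a b x z -> y = z.
Proof.
intros HM Ha Hb Hx Hy Hz; revert a Ha b Hb x Hx y Hy z Hz.
refine (transfer (fun T => forall a, dom T a -> forall b, dom T b ->
  forall x, dom T x -> forall y, dom T y -> forall z, dom T z ->
  sbeta T a b x y -> sbeta T a b x z -> y = z) M _ HM _);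
  [unfold sbeta, smodulus; fo_tac|].
setoid_rewrite sbeta_nat; intros; congruence.
Qed.

Lemma beta_total M a b x : true_arithmetic M -> a ∈ car M -> b ∈ car M -> x ∈ car M ->
  exists y, y ∈ car M /\ beta M a b x y.
Proof.
intros HM Ha Hb Hx; revert a Ha b Hb x Hx.
refine (transfer (fun T => forall a, dom T a -> forall b, dom T b ->
  forall x, dom T x -> exists y, dom T y /\ sbeta T a b x y) M _ HM _);
  [unfold sbeta, smodulus; fo_tac|].
setoid_rewrite sbeta_nat; intros; eexists; split; [exact I | reflexivity].
Qed.

(** The function that fixes the set coded by p, q and sends every other point to its successor has
    exactly this set as its fixed points. In the standard model [goedel_beta] codes it. *)
Lemma fixing_code M p q n : true_arithmetic M ->
  p ∈ car M -> q ∈ car M -> n ∈ car M ->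
  exists a, a ∈ car M /\ exists b, b ∈ car M /\
    forall x, x ∈ car M -> less M x n ->
      (beta M p q x (zero M) -> beta M a b x x) /\
      (~ beta M p q x (zero M) -> beta M a b x (plus M x (one M))).
Proof.
intros HM Hp Hq Hn; revert p Hp q Hq n Hn.
refine (transfer (fun T => forall p, dom T p -> forall q, dom T q ->
  forall n, dom T n -> exists a, dom T a /\ exists b, dom T b /\
  forall x, dom T x -> slt T x n ->
    (sbeta T p q x (s0 T) -> sbeta T a b x x) /\
    (~ sbeta T p q x (s0 T) -> sbeta T a b x (sadd T x (s1 T)))) M _ HM _);
  [unfold sbeta, smodulus; fo_tac|].
setoid_rewrite sbeta_nat; cbn -[Nat.modulo Nat.mul Nat.add]; intros p _ q _ n _.
destruct (goedel_beta
  (fun x => if Nat.eq_dec 0 (p mod (1 + (x + 1) * q)) then x else x + 1) n)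
  as [a [b H]].
exists a; split; [exact I|]; exists b; split; [exact I|].
intros x _ Hx; rewrite (H x Hx); destruct Nat.eq_dec; split; intros; tauto.
Qed.

Lemma identity_code M n : true_arithmetic M -> n ∈ car M ->
  exists a, a ∈ car M /\ exists b, b ∈ car M /\
    forall x, x ∈ car M -> less M x n -> beta M a b x x.
Proof.
intros HM Hn; revert n Hn.
refine (transfer (fun T => forall n, dom T n -> exists a, dom T a /\
  exists b, dom T b /\ forall x, dom T x -> slt T x n -> sbeta T a b x x) M _ HM _);
  [unfold sbeta, smodulus; fo_tac|].
setoid_rewrite sbeta_nat; cbn -[Nat.modulo Nat.mul Nat.add]; intros n _.
destruct (goedel_beta (fun x => x) n) as [a [b H]].
exists a; split; [exact I|]; exists b; split; [exact I|].
intros x _ Hx; symmetry; exact (H x Hx).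
Qed.

(** A finite set in the sense of [M] is presented by a coded sequence of length m, which makes
    statements about it first-order in c, d, m. *)
Definition range (M : arith) (c d m y : set) : Prop :=
  exists x, x ∈ car M /\ less M x m /\ beta M c d x y.

Definition code_injective (M : arith) (c d m : set) : Prop :=
  forall x, x ∈ car M -> forall x', x' ∈ car M -> forall y, y ∈ car M ->
  less M x m -> less M x' m -> beta M c d x y -> beta M c d x' y -> x = x'.

(** In the standard model a duplicate-free list contained in the concatenation of two lists is no
    longer than the two together. Monotonicity and uniqueness of cardinality come from this same
    inequality. *)
Lemma range_subadditive M c d m c1 d1 m1 c2 d2 m2 : true_arithmetic M ->
  c ∈ car M -> d ∈ car M -> m ∈ car M ->
  c1 ∈ car M -> d1 ∈ car M -> m1 ∈ car M ->
  c2 ∈ car M -> d2 ∈ car M -> m2 ∈ car M ->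
  code_injective M c d m ->
  (forall y, y ∈ car M -> range M c d m y -> range M c1 d1 m1 y \/ range M c2 d2 m2 y) ->
  leq M m (plus M m1 m2).
Proof.
intros HM Hc Hd Hm Hc1 Hd1 Hm1 Hc2 Hd2 Hm2.
revert c Hc d Hd m Hm c1 Hc1 d1 Hd1 m1 Hm1 c2 Hc2 d2 Hd2 m2 Hm2.
refine (transfer (fun T => forall c, dom T c -> forall d, dom T d ->
  forall m, dom T m -> forall c1, dom T c1 -> forall d1, dom T d1 ->
  forall m1, dom T m1 -> forall c2, dom T c2 -> forall d2, dom T d2 ->
  forall m2, dom T m2 -> sinjective T c d m ->
  (forall y, dom T y -> srange T c d m y -> srange T c1 d1 m1 y \/ srange T c2 d2 m2 y) ->
  slt T m (sadd T m1 m2) \/ m = sadd T m1 m2) M _ HM _);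
  [unfold sinjective, srange, sbeta, smodulus; fo_tac|].
setoid_rewrite srange_nat; setoid_rewrite sinjective_nat.
cbn -[Nat.modulo Nat.mul Nat.add].
intros c _ d _ m _ c1 _ d1 _ m1 _ c2 _ d2 _ m2 _ N H.
enough (m <= m1 + m2) by lia.
assert (I0 : forall l1 l2 : list nat,
  incl (map (fun x => c mod (1 + (x + 1) * d)) (seq 0 m)) (l1 ++ l2) -> m <= length l1 + length l2).
{ intros l1 l2 K; apply (NoDup_incl_length N) in K.
  rewrite length_map, length_seq, length_app in K; exact K. }
specialize (I0 (map (fun x => c1 mod (1 + (x + 1) * d1)) (seq 0 m1))
  (map (fun x => c2 mod (1 + (x + 1) * d2)) (seq 0 m2))).
rewrite !length_map, !length_seq in I0; apply I0.
intros y Hy; apply in_or_app, H; [exact I | exact Hy].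
Qed.

Lemma range_coded M c d m n : true_arithmetic M ->
  c ∈ car M -> d ∈ car M -> m ∈ car M -> n ∈ car M ->
  exists p, p ∈ car M /\ exists q, q ∈ car M /\
    forall x, x ∈ car M -> less M x n -> (range M c d m x <-> beta M p q x (zero M)).
Proof.
intros HM Hc Hd Hm Hn; revert c Hc d Hd m Hm n Hn.
(* The equivalence is replaced by the pair of implications to which it unfolds, since [fo_tac] has
   no case for equivalences. *)
enough (H : forall c, c ∈ car M -> forall d, d ∈ car M -> forall m, m ∈ car M ->
  forall n, n ∈ car M -> exists p, p ∈ car M /\ exists q, q ∈ car M /\
    forall x, x ∈ car M -> less M x n ->
    (range M c d m x -> beta M p q x (zero M)) /\
    (beta M p q x (zero M) -> range M c d m x)) by exact H.
refine (transfer (fun T => forall c, dom T c -> forall d, dom T d ->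
  forall m, dom T m -> forall n, dom T n -> exists p, dom T p /\ exists q, dom T q /\
  forall x, dom T x -> slt T x n -> (srange T c d m x -> sbeta T p q x (s0 T)) /\
    (sbeta T p q x (s0 T) -> srange T c d m x)) M _ HM _);
  [unfold srange, sbeta, smodulus; fo_tac|].
setoid_rewrite srange_nat; setoid_rewrite sbeta_nat.
cbn -[Nat.modulo Nat.mul Nat.add]; intros c _ d _ m _ n _.
set (l := map _ _).
destruct (goedel_beta (fun x => if in_dec Nat.eq_dec x l then 0 else 1) n) as [a [b H]].
exists a; split; [exact I|]; exists b; split; [exact I|].
intros x _ Hx; rewrite (H x Hx); destruct in_dec; split; intros; auto; easy.
Qed.

Lemma NoDup_app_disjoint {A : Type} (l1 l2 : list A) a :
  NoDup (l1 ++ l2) -> In a l1 -> ~ In a l2.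
Proof.
induction l1 as [|b l1 IH]; simpl; intros N H K; [exact H|].
apply NoDup_cons_iff in N as [N1 N2]; destruct H as [<-|H].
- apply N1, in_or_app; auto.
- exact (IH N2 H K).
Qed.

(** The sequence is cut at h = ⌊m/2⌋: the initial piece keeps its code, and the shifted rest gets a
    new one. Of the halving only m < 2h + 2 and m < 2k + 2 are recorded, which hold for either
    parity and are written without division. *)
Lemma range_split M c d m : true_arithmetic M ->
  c ∈ car M -> d ∈ car M -> m ∈ car M -> code_injective M c d m ->
  exists h, h ∈ car M /\ exists c', c' ∈ car M /\ exists d', d' ∈ car M /\
  exists k, k ∈ car M /\ code_injective M c d h /\ code_injective M c' d' k /\
    less M m (plus M (plus M (plus M h h) (one M)) (one M)) /\
    less M m (plus M (plus M (plus M k k) (one M)) (one M)) /\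
    forall y, y ∈ car M ->
      (range M c d h y -> range M c d m y) /\ (range M c' d' k y -> range M c d m y) /\
      ~ (range M c d h y /\ range M c' d' k y).
Proof.
intros HM Hc Hd Hm; revert c Hc d Hd m Hm.
refine (transfer (fun T => forall c, dom T c -> forall d, dom T d ->
  forall m, dom T m -> sinjective T c d m ->
  exists h, dom T h /\ exists c', dom T c' /\ exists d', dom T d' /\
  exists k, dom T k /\ sinjective T c d h /\ sinjective T c' d' k /\
    slt T m (sadd T (sadd T (sadd T h h) (s1 T)) (s1 T)) /\
    slt T m (sadd T (sadd T (sadd T k k) (s1 T)) (s1 T)) /\
    forall y, dom T y ->
      (srange T c d h y -> srange T c d m y) /\ (srange T c' d' k y -> srange T c d m y) /\
      ~ (srange T c d h y /\ srange T c' d' k y)) M _ HM _);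
  [unfold sinjective, srange, sbeta, smodulus; fo_tac|].
setoid_rewrite srange_nat; setoid_rewrite sinjective_nat.
cbn -[Nat.modulo Nat.mul Nat.add Nat.div]; intros c _ d _ m _ N.
set (f := fun x => c mod (1 + (x + 1) * d)) in *.
pose proof (Nat.div_mod_eq m 2) as E; pose proof (Nat.mod_upper_bound m 2).
set (h := m / 2) in *; set (k := m - h).
destruct (goedel_beta (fun x => f (h + x)) k) as [c' [d' H']].
assert (E' : map (fun x => c' mod (1 + (x + 1) * d')) (seq 0 k) = map f (seq h k)).
{ rewrite (map_ext_in _ (fun x => f (h + x))).
  - rewrite <- (map_map (fun x => h + x) f); f_equal.
    replace (seq h k) with (seq (h + 0) k) by (f_equal; lia); clear.
    generalize 0; induction k as [|k IH]; intros s; [reflexivity|].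
    cbn [seq map]; rewrite IH; do 2 f_equal; lia.
  - intros x Hx; apply in_seq in Hx; apply H'; lia. }
assert (Em : map f (seq 0 m) = map f (seq 0 h) ++ map f (seq h k)).
{ rewrite <- map_app, <- seq_app; do 2 f_equal; lia. }
rewrite Em in N |- *.
exists h; split; [exact I|]; exists c'; split; [exact I|]; exists d'; split; [exact I|].
exists k; split; [exact I|]; rewrite E'.
repeat split; try lia.
- exact (NoDup_app_remove_r _ _ N).
- exact (NoDup_app_remove_l _ _ N).
- intros Hy; apply in_or_app; auto.
- intros Hy; apply in_or_app; auto.
- intros [H1 H2].
  apply in_map_iff in H1, H2; destruct H1 as [x1 [<- H1]], H2 as [x2 [E2 H2]].
  apply (NoDup_app_disjoint _ _ (f x1) N); apply in_map_iff; [exists x1 | exists x2]; auto.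
Qed.

(** ** Cardinality and measure *)

Definition graph (M : arith) (c d n : set) : set :=
  sep (fun z => exists x y, z = opair x y /\ beta M c d x y) (cprod (seg M n) (car M)).

Lemma opair_graph M c d n x y :
  opair x y ∈ graph M c d n <-> x ∈ seg M n /\ y ∈ car M /\ beta M c d x y.
Proof.
unfold graph; rewrite mem_sep, opair_cprod; split.
- intros [[Hx Hy] [x' [y' [E H]]]]; apply opair_inj in E as [<- <-]; auto.
- intros [Hx [Hy H]]; split; [auto|]; exists x, y; auto.
Qed.

Lemma graph_is_fun M c d n : true_arithmetic M -> c ∈ car M -> d ∈ car M ->
  is_fun (graph M c d n) (seg M n) (car M).
Proof.
intros HM Hc Hd; split; [intros z Hz; apply mem_sep in Hz; apply Hz|].
intros x Hx; assert (Hx' := proj1 (proj1 (mem_seg _ _ _) Hx)).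
destruct (beta_total M c d x HM Hc Hd Hx') as [y [Hy H]]; exists y; split.
- apply opair_graph; auto.
- intros z Hz; apply opair_graph in Hz as [_ [Hz K]].
  exact (beta_unique M c d x y z HM Hc Hd Hx' Hy Hz H K).
Qed.

Lemma cprod_subset_ext f g x y : f ⊆ cprod x y -> g ⊆ cprod x y ->
  (forall a b, opair a b ∈ f <-> opair a b ∈ g) -> f = g.
Proof.
intros Hf Hg H; apply set_ext; intros z; split; intros Hz.
- destruct (proj1 (mem_cprod _ _ _) (Hf z Hz)) as [a [b [_ [_ ->]]]]; apply H, Hz.
- destruct (proj1 (mem_cprod _ _ _) (Hg z Hz)) as [a [b [_ [_ ->]]]]; apply H, Hz.
Qed.

(** Remainders exist and are unique, so a code determines its function on the segment; quantifying
    over coded functions becomes quantifying over [M]. *)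
Lemma coded_fun_iff M n f : true_arithmetic M ->
  coded_fun M n f <-> exists c d, c ∈ car M /\ d ∈ car M /\ f = graph M c d n.
Proof.
intros HM; split.
- intros [Hf [c [d [Hc [Hd H]]]]]; exists c, d; repeat split; auto.
  apply (cprod_subset_ext _ _ (seg M n) (car M)); [apply Hf | |].
  { apply graph_is_fun; assumption. }
  intros x y; rewrite opair_graph; split.
  + intros K; destruct (is_fun_dom _ _ _ _ _ Hf K) as [Hx Hy].
    rewrite <- (ap_eq _ _ _ _ _ Hf K) at 2; auto.
  + intros [Hx [Hy K]].
    rewrite (beta_unique M c d x y (ap f x)); auto.
    * eapply opair_ap; eassumption.
    * apply mem_seg in Hx; tauto.
    * eapply ap_in; eassumption.
- intros [c [d [Hc [Hd ->]]]]; pose proof (graph_is_fun M c d n HM Hc Hd) as Hf.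
  split; [exact Hf|]; exists c, d; split; [exact Hc|]; split; [exact Hd|]; intros x Hx.
  apply (opair_graph M c d n x), (opair_ap _ _ _ _ Hf Hx).
Qed.

Lemma mcard_iff M A m : true_arithmetic M ->
  mcard M A m <-> m ∈ car M /\ exists c, c ∈ car M /\ exists d, d ∈ car M /\
    code_injective M c d m /\ forall y, y ∈ A <-> y ∈ car M /\ range M c d m y.
Proof.
intros HM; unfold mcard; split; intros [Hm H]; (split; [exact Hm|]).
- destruct H as [f [Hf [[Hb Hi] Hs]]].
  apply coded_fun_iff in Hf as [c [d [Hc [Hd ->]]]]; [|assumption].
  exists c; split; [exact Hc|]; exists d; split; [exact Hd|]; split.
  + intros x Hx x' Hx' y Hy L L' B B'; apply (Hi _ _ y); apply opair_graph.
    * rewrite mem_seg; auto.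
    * rewrite mem_seg; auto.
  + intros y; split.
    * intros Hy; destruct (Hs y Hy) as [x Hx].
      apply opair_graph in Hx as [Hx [Hy' B]]; apply mem_seg in Hx as [Hx L].
      split; [exact Hy'|]; exists x; auto.
    * intros [Hy [x [Hx [L B]]]].
      apply (is_fun_dom _ _ _ x y Hb), opair_graph; rewrite mem_seg; auto.
- destruct H as [c [Hc [d [Hd [Hi H]]]]].
  exists (graph M c d m); split; [apply coded_fun_iff; [assumption|]; exists c, d; auto|].
  pose proof (graph_is_fun M c d m HM Hc Hd) as Hf.
  split; [split; [split|]|].
  + intros z Hz; destruct (proj1 (mem_cprod _ _ _) (proj1 Hf z Hz)) as [x [y [_ [_ ->]]]].
    apply opair_graph in Hz as [Hx [Hy B]]; apply opair_cprod; split; [exact Hx|].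
    apply mem_seg in Hx as [Hx L]; apply H; split; [exact Hy|]; exists x; auto.
  + apply Hf.
  + intros x x' y K K'; apply opair_graph in K as [Hx [Hy B]], K' as [Hx' [_ B']].
    apply mem_seg in Hx as [Hx L], Hx' as [Hx' L'].
    exact (Hi x Hx x' Hx' y Hy L L' B B').
  + intros y Hy; apply H in Hy as [Hy [x [Hx [L B]]]]; exists x.
    apply opair_graph; rewrite mem_seg; auto.
Qed.

Lemma mcard_car M A m : mcard M A m -> m ∈ car M.
Proof. intros [H _]; exact H. Qed.

Lemma mcard_subadditive M A m A1 m1 A2 m2 : true_arithmetic M ->
  mcard M A m -> mcard M A1 m1 -> mcard M A2 m2 ->
  (forall y, y ∈ A -> y ∈ A1 \/ y ∈ A2) -> leq M m (plus M m1 m2).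
Proof.
intros HM H H1 H2 K; apply mcard_iff in H, H1, H2; try assumption.
destruct H as [Hm [c [Hc [d [Hd [Hi H]]]]]].
destruct H1 as [Hm1 [c1 [Hc1 [d1 [Hd1 [_ H1]]]]]].
destruct H2 as [Hm2 [c2 [Hc2 [d2 [Hd2 [_ H2]]]]]].
apply (range_subadditive M c d m c1 d1 m1 c2 d2 m2); try assumption.
intros y Hy L; destruct (K y) as [L'|L']; [apply H; auto | left | right].
- apply H1, L'.
- apply H2, L'.
Qed.

Lemma mcard_empty M A : true_arithmetic M -> (forall y, y ∉ A) -> mcard M A (zero M).
Proof.
intros HM H; assert (Hz : zero M ∈ car M) by apply HM.
apply mcard_iff; [assumption|]; split; [exact Hz|].
exists (zero M); split; [exact Hz|]; exists (zero M); split; [exact Hz|]; split.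
- intros x Hx x' Hx' y Hy L; destruct (not_less_zero M x HM L).
- intros y; split; [intros K; destruct (H y K)|].
  intros [_ [x [_ [L _]]]]; destruct (not_less_zero M x HM L).
Qed.

Lemma mcard_mono M A m A' m' : true_arithmetic M ->
  mcard M A m -> mcard M A' m' -> A ⊆ A' -> leq M m m'.
Proof.
intros HM H H' K; rewrite <- (plus_zero M m' HM) by exact (mcard_car _ _ _ H').
apply (mcard_subadditive M A m A' m' empty (zero M)); auto.
apply mcard_empty; [exact HM | apply mem_empty].
Qed.

Lemma mcard_seg M n : true_arithmetic M -> n ∈ car M -> mcard M (seg M n) n.
Proof.
intros HM Hn; destruct (identity_code M n HM Hn) as [c [Hc [d [Hd H]]]].
apply mcard_iff; [assumption|]; split; [exact Hn|].
assert (U : forall x y, x ∈ car M -> y ∈ car M -> less M x n -> beta M c d x y -> x = y).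
{ intros x y Hx Hy L B; apply (beta_unique M c d x); auto. }
exists c; split; [exact Hc|]; exists d; split; [exact Hd|]; split.
- intros x Hx x' Hx' y Hy L L' B B'; rewrite (U x y), (U x' y); auto.
- intros y; rewrite mem_seg; split.
  + intros [Hy L]; split; [exact Hy|]; exists y; auto.
  + intros [Hy [x [Hx [L B]]]]; rewrite <- (U x y); auto.
Qed.

Lemma mcard_unique M A m m' : true_arithmetic M -> mcard M A m -> mcard M A m' -> m = m'.
Proof.
intros HM H H'; apply (leq_antisym M); try assumption.
- exact (mcard_car _ _ _ H).
- exact (mcard_car _ _ _ H').
- apply (mcard_mono M A m A m'); auto; intros z; auto.
- apply (mcard_mono M A m' A m); auto; intros z; auto.
Qed.

Lemma mcard_coded M A m n : true_arithmetic M -> n ∈ car M ->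
  mcard M A m -> A ⊆ seg M n -> coded_set M n A.
Proof.
intros HM Hn H K; split; [exact K|].
apply mcard_iff in H as [Hm [c [Hc [d [Hd [_ H]]]]]]; [|assumption].
destruct (range_coded M c d m n HM Hc Hd Hm Hn) as [p [Hp [q [Hq L]]]].
exists p, q; split; [exact Hp|]; split; [exact Hq|].
intros x Hx; apply mem_seg in Hx as [Hx Lx]; rewrite <- L, H by assumption; tauto.
Qed.

Lemma mcard_split M A m : true_arithmetic M -> mcard M A m ->
  exists A1 m1 A2 m2, A1 ⊆ A /\ A2 ⊆ A /\ (forall x, x ∈ A1 -> x ∉ A2) /\
    mcard M A1 m1 /\ mcard M A2 m2 /\
    less M m (plus M (plus M (plus M m1 m1) (one M)) (one M)) /\
    less M m (plus M (plus M (plus M m2 m2) (one M)) (one M)).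
Proof.
intros HM H; apply mcard_iff in H as [Hm [c [Hc [d [Hd [Hi H]]]]]]; [|assumption].
destruct (range_split M c d m HM Hc Hd Hm Hi)
  as [h [Hh [c' [Hc' [d' [Hd' [k [Hk [I1 [I2 [L1 [L2 S]]]]]]]]]]]].
exists (sep (range M c d h) (car M)), h, (sep (range M c' d' k) (car M)), k.
split; [|split; [|split; [|split; [|split; [|split]]]]].
- intros y Hy; apply mem_sep in Hy as [Hy R]; apply H.
  exact (conj Hy (proj1 (S y Hy) R)).
- intros y Hy; apply mem_sep in Hy as [Hy R]; apply H.
  exact (conj Hy (proj1 (proj2 (S y Hy)) R)).
- intros y Hy Hy'; apply mem_sep in Hy as [Hy R], Hy' as [_ R'].
  exact (proj2 (proj2 (S y Hy)) (conj R R')).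
- apply mcard_iff; [assumption|]; split; [exact Hh|].
  exists c; split; [exact Hc|]; exists d; split; [exact Hd|]; split; [exact I1|].
  intros y; exact (mem_sep _ _ _).
- apply mcard_iff; [assumption|]; split; [exact Hk|].
  exists c'; split; [exact Hc'|]; exists d'; split; [exact Hd'|]; split; [exact I2|].
  intros y; exact (mem_sep _ _ _).
- exact L1.
- exact L2.
Qed.

Lemma nmul_one M x : true_arithmetic M -> x ∈ car M -> nmul M 1 x = x.
Proof.
intros HM; revert x.
refine (transfer (fun T => forall x, dom T x -> sadd T (s0 T) x = x) M _ HM _);
  [fo_tac|].
reflexivity.
Qed.

Lemma nmul_zero M n : true_arithmetic M -> nmul M n (zero M) = zero M.
Proof.
intros HM; rewrite <- snmul_nmul.
refine (transfer (fun T => snmul T n (s0 T) = s0 T) M _ HM _); [fo_tac|].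
rewrite snmul_nat; cbn; lia.
Qed.

(** This is p/q ≤ p'/q' ≤ a/w, cleared of denominators. *)
Lemma nmul_leq_scale M p q p' q' w a : true_arithmetic M -> w ∈ car M -> a ∈ car M ->
  0 < q' -> p * q' <= p' * q ->
  leq M (nmul M p' w) (nmul M q' a) -> leq M (nmul M p w) (nmul M q a).
Proof.
intros HM Hw Ha Hq H; rewrite <- !snmul_nmul; revert w Hw a Ha.
refine (transfer (fun T => forall w, dom T w -> forall a, dom T a ->
  slt T (snmul T p' w) (snmul T q' a) \/ snmul T p' w = snmul T q' a ->
  slt T (snmul T p w) (snmul T q a) \/ snmul T p w = snmul T q a) M _ HM _);
  [fo_tac|].
setoid_rewrite snmul_nat; cbn; intros w _ a _ K.
enough (p * w <= q * a) by lia.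
assert (p' * w <= q' * a) by lia; clear K.
apply (Nat.mul_le_mono_pos_l _ _ q'); [assumption|]; nia.
Qed.

(** Keeps the standard fractions below a/w at most 1, so that they have a supremum. *)
Lemma nmul_leq_bound M p q w a : true_arithmetic M -> w ∈ car M -> a ∈ car M ->
  less M (zero M) w -> leq M a w -> leq M (nmul M p w) (nmul M q a) -> p <= q.
Proof.
intros HM Hw Ha H0 H K; destruct (le_lt_dec p q) as [|L]; [assumption|exfalso].
rewrite <- !snmul_nmul in K; revert w Hw a Ha H0 H K.
refine (transfer (fun T => forall w, dom T w -> forall a, dom T a ->
  slt T (s0 T) w -> slt T a w \/ a = w ->
  slt T (snmul T p w) (snmul T q a) \/ snmul T p w = snmul T q a -> False) M _ HM _);
  [fo_tac|].
setoid_rewrite snmul_nat; cbn; intros; nia.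
Qed.

(** Otherwise w ≤ k c ≤ k c1 + k c2 ≤ 2w/3, while w > 0. Three is the least factor for which the two
    summands together stay below w. *)
Lemma null_sum_bound M k c c1 c2 w : true_arithmetic M ->
  c ∈ car M -> c1 ∈ car M -> c2 ∈ car M -> w ∈ car M ->
  less M (zero M) w -> leq M c (plus M c1 c2) -> leq M w (nmul M k c) ->
  leq M (nmul M (3 * k) c1) w -> leq M (nmul M (3 * k) c2) w -> False.
Proof.
intros HM Hc Hc1 Hc2 Hw.
rewrite <- !snmul_nmul; revert c Hc c1 Hc1 c2 Hc2 w Hw.
refine (transfer (fun T => forall c, dom T c -> forall c1, dom T c1 ->
  forall c2, dom T c2 -> forall w, dom T w -> slt T (s0 T) w ->
  slt T c (sadd T c1 c2) \/ c = sadd T c1 c2 ->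
  slt T w (snmul T k c) \/ w = snmul T k c ->
  slt T (snmul T (3 * k) c1) w \/ snmul T (3 * k) c1 = w ->
  slt T (snmul T (3 * k) c2) w \/ snmul T (3 * k) c2 = w -> False) M _ HM _);
  [fo_tac|].
setoid_rewrite snmul_nat; cbn -[Nat.mul]; intros c _ c1 _ c2 _ w _ H0 H1 H2 H3 H4.
assert (c <= c1 + c2) by lia; assert (w <= k * c) by lia.
assert (k * c <= k * c1 + k * c2) by nia; lia.
Qed.

(** If h were 0, then a ≤ 1 and w ≤ n, against n < w. Hence h ≥ 1 and a ≤ 2h + 1 ≤ 3h, which is the
    origin of the factor 3. *)
Lemma half_bound M n a h w : true_arithmetic M ->
  a ∈ car M -> h ∈ car M -> w ∈ car M ->
  less M (nmul M n (one M)) w -> leq M w (nmul M n a) ->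
  less M a (plus M (plus M (plus M h h) (one M)) (one M)) ->
  leq M w (nmul M (3 * n) h).
Proof.
intros HM Ha Hh Hw.
rewrite <- !snmul_nmul; revert a Ha h Hh w Hw.
refine (transfer (fun T => forall a, dom T a -> forall h, dom T h -> forall w, dom T w ->
  slt T (snmul T n (s1 T)) w ->
  slt T w (snmul T n a) \/ w = snmul T n a ->
  slt T a (sadd T (sadd T (sadd T h h) (s1 T)) (s1 T)) ->
  slt T w (snmul T (3 * n) h) \/ w = snmul T (3 * n) h) M _ HM _);
  [fo_tac|].
setoid_rewrite snmul_nat; cbn -[Nat.mul]; intros a _ h _ w _ H0 H1 H2.
enough (w <= 3 * n * h) by lia.
assert (w <= n * a) by lia; destruct h as [|h]; [exfalso; nia|].
assert (a <= 3 * S h) by lia; nia.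
Qed.

Lemma ratio_lt p q p' q' : 0 < q -> 0 < q' ->
  (INR p / INR q < INR p' / INR q')%R -> p * q' < p' * q.
Proof.
intros Hq Hq' H; apply lt_0_INR in Hq, Hq'; apply INR_lt; rewrite !mult_INR.
apply (Rmult_lt_compat_r (INR q * INR q')) in H; [|apply Rmult_lt_0_compat; assumption].
replace (INR p / INR q * (INR q * INR q'))%R with (INR p * INR q')%R in H by (field; lra).
replace (INR p' / INR q' * (INR q * INR q'))%R with (INR p' * INR q)%R in H by (field; lra).
exact H.
Qed.

Lemma inv_INR_lt r : (0 < r)%R -> exists n, 0 < n /\ (INR 1 / INR n < r)%R.
Proof.
intros H; destruct (archimed_cor1 r H) as [n [Hn Hn']]; exists n; split; [exact Hn'|].
unfold Rdiv; simpl (INR 1); rewrite Rmult_1_l; exact Hn.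
Qed.

(** The standard part is the supremum of the standard fractions p/q ≤ a/w. If w ≤ n a, then 1/n is
    one of them, which makes the supremum positive. *)
Lemma standard_part_exists M a w : true_arithmetic M -> a ∈ car M -> w ∈ car M ->
  less M (zero M) w -> leq M a w ->
  exists r, is_st M a w r /\ forall n, leq M w (nmul M n a) -> (0 < r)%R.
Proof.
intros HM Ha Hw H0 Haw.
pose (E := fun x => exists p q, 0 < q /\ leq M (nmul M p w) (nmul M q a) /\
  x = (INR p / INR q)%R).
assert (E0 : E 0%R).
{ exists 0, 1; split; [lia|]; split.
  - apply zero_leq, nmul_car; [exact HM | apply HM | exact Ha].
  - simpl; unfold Rdiv; ring. }
destruct (completeness E) as [r [Hub Hlub]].
{ exists 1%R; intros x [p [q [Hq [L ->]]]].
  apply nmul_leq_bound in L; try assumption.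
  apply lt_0_INR in Hq; apply le_INR in L.
  apply (Rmult_le_reg_r (INR q)); [exact Hq|].
  unfold Rdiv; rewrite Rmult_assoc, Rinv_l, Rmult_1_l, Rmult_1_r; lra. }
{ exists 0%R; exact E0. }
exists r; split; [split; [apply Hub, E0|]; intros p q Hq; split; intros L|].
- assert (N : exists x, E x /\ (INR p / INR q < x)%R).
  { apply NNPP; intros N; apply (Rlt_irrefl r).
    apply Rle_lt_trans with (2 := L), Hlub; intros x Hx.
    apply Rnot_lt_le; intros K; apply N; exists x; auto. }
  destruct N as [x [[p' [q' [Hq' [K ->]]]] L']].
  apply (nmul_leq_scale M p q p' q'); try assumption.
  apply ratio_lt in L'; lia.
- apply leq_iff; [exact HM | apply nmul_car; [apply HM | exact Ha]
    | apply nmul_car; [apply HM | exact Hw] |].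
  intros K; apply (Rlt_not_le _ _ L), Hub; exists p, q; repeat split; auto.
  left; exact K.
- intros n K; apply Rlt_le_trans with (INR 1 / INR n)%R.
  + destruct n as [|n].
    { exfalso; exact (less_asym _ _ _ HM H0 K). }
    apply Rdiv_lt_0_compat; apply lt_0_INR; lia.
  + apply Hub; exists 1, n; rewrite nmul_one by assumption; repeat split; auto.
    destruct n as [|n]; [|lia].
    exfalso; exact (less_asym _ _ _ HM H0 K).
Qed.

Lemma is_mu_iff M Om A r : true_arithmetic M -> Om ∈ car M ->
  is_mu M Om A r <-> exists a, mcard M A a /\ is_st M a Om r.
Proof.
intros HM HO; pose proof (mcard_seg M Om HM HO) as HS; split.
- intros [a [w [Ha [Hw H]]]]; rewrite (mcard_unique M _ _ _ HM Hw HS) in H.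
  exists a; auto.
- intros [a [Ha H]]; exists a, Om; auto.
Qed.

Lemma null_empty M Om A : true_arithmetic M -> Om ∈ car M ->
  (forall x, x ∉ A) -> is_mu M Om A 0%R.
Proof.
intros HM HO H; apply is_mu_iff; [assumption|assumption|].
exists (zero M); split; [apply mcard_empty; assumption|].
split; [lra|]; intros p q Hq; apply lt_0_INR in Hq; split; intros L.
- exfalso; pose proof (pos_INR p).
  apply (Rlt_not_le _ _ L); apply Rle_mult_inv_pos; assumption.
- rewrite nmul_zero by assumption; apply zero_leq, nmul_car; [exact HM | apply HM | exact HO].
Qed.

(** Eliminates the reals: st(a/[Om]) is positive iff a/[Om] ≥ 1/n for some standard n. Only the
    quantifier over n then refers to something outside [M]. *)
Lemma Aplus_iff M Om A : true_arithmetic M -> Om ∈ car M -> less M (zero M) Om ->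
  A ∈ Aplus M Om <->
  A ⊆ seg M Om /\ exists a, mcard M A a /\ exists n, leq M Om (nmul M n a).
Proof.
intros HM HO H0; unfold Aplus, Acal; rewrite !mem_sep, mem_power; split.
- intros [[HA _] [r [H Hr]]]; split; [exact HA|].
  apply is_mu_iff in H as [a [Ha [_ H]]]; [|assumption|assumption].
  exists a; split; [exact Ha|].
  destruct (inv_INR_lt r Hr) as [n [Hn L]]; exists n.
  rewrite <- (nmul_one M Om) by assumption; apply (H 1 n Hn), L.
- intros [HA [a [Ha [n L]]]]; pose proof (mcard_car _ _ _ Ha) as Ha'.
  split; [split; [exact HA | apply (mcard_coded M A a); assumption]|].
  destruct (standard_part_exists M a Om HM Ha' HO H0) as [r [Hr K]].
  { apply (mcard_mono M A a (seg M Om) Om); try assumption; apply mcard_seg; assumption. }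
  exists r; split; [|exact (K n L)].
  apply is_mu_iff; [assumption|assumption|]; exists a; auto.
Qed.

Lemma le_star_subset M Om A B : true_arithmetic M -> Om ∈ car M ->
  A ⊆ B -> le_star M Om A B.
Proof.
intros HM HO H; apply null_empty; try assumption.
intros x Hx; apply mem_setminus in Hx as [Hx Hx']; exact (Hx' (H x Hx)).
Qed.

(** Shows that disjoint positive sets A1 and A2 are incompatible: a common extension r would be the
    union of the null sets r \ A1 and r \ A2. The fraction 1/(3n) at which nullity is used is the
    one required by [null_sum_bound]. *)
Lemma null_union M Om A A1 A2 : true_arithmetic M -> Om ∈ car M -> less M (zero M) Om ->
  A ∈ Aplus M Om -> is_mu M Om A1 0%R -> is_mu M Om A2 0%R ->
  ~ (forall x, x ∈ A -> x ∈ A1 \/ x ∈ A2).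
Proof.
intros HM HO H0 HA H1 H2 K.
apply Aplus_iff in HA as [_ [a [Ha [n L]]]]; try assumption.
apply is_mu_iff in H1 as [a1 [Ha1 [_ H1]]], H2 as [a2 [Ha2 [_ H2]]]; try assumption.
assert (Hn : 0 < n).
{ destruct n as [|n]; [|lia]; exfalso; exact (less_asym _ _ _ HM H0 L). }
assert (P : (0 < INR 1 / INR (3 * n))%R).
{ apply Rdiv_lt_0_compat; apply lt_0_INR; lia. }
apply (null_sum_bound M n a a1 a2 Om); try assumption;
  try (eapply mcard_car; eassumption).
- eapply mcard_subadditive; eassumption.
- rewrite <- (nmul_one M Om) by assumption; apply (H1 1 (3 * n)); [lia | exact P].
- rewrite <- (nmul_one M Om) by assumption; apply (H2 1 (3 * n)); [lia | exact P].
Qed.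

Lemma Aplus_split M Om A : true_arithmetic M -> nonstandard M Om -> A ∈ Aplus M Om ->
  exists A1 A2, A1 ∈ Aplus M Om /\ A2 ∈ Aplus M Om /\ A1 ⊆ A /\ A2 ⊆ A /\
    forall x, x ∈ A1 -> x ∉ A2.
Proof.
intros HM [HO HN] HA; pose proof (HN 0) as H0; simpl in H0.
apply Aplus_iff in HA as [HA [a [Ha [n L]]]]; try assumption.
destruct (mcard_split M A a HM Ha)
  as [A1 [a1 [A2 [a2 [S1 [S2 [D [Ha1 [Ha2 [L1 L2]]]]]]]]]].
pose proof (mcard_car _ _ _ Ha); pose proof (mcard_car _ _ _ Ha1).
pose proof (mcard_car _ _ _ Ha2).
exists A1, A2; split; [|split; [|auto]]; apply Aplus_iff; try assumption.
- split; [intros x Hx; apply HA, S1, Hx|].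
  exists a1; split; [exact Ha1|]; exists (3 * n); apply (half_bound M n a); auto.
- split; [intros x Hx; apply HA, S2, Hx|].
  exists a2; split; [exact Ha2|]; exists (3 * n); apply (half_bound M n a); auto.
Qed.

(** ** Definability in a transitive model *)

Fixpoint zren (r : nat -> nat) (p : zform) : zform :=
  match p with
  | zEq i j => zEq (r i) (r j)
  | zIn i j => zIn (r i) (r j)
  | zBot => zBot
  | zImp p q => zImp (zren r p) (zren r q)
  | zAll p => zAll (zren (fun n => match n with O => O | S k => S (r k) end) p)
  end.

Lemma zsat_zren W p : forall r e, zsat W e (zren r p) <-> zsat W (fun n => e (r n)) p.
Proof.
induction p as [i j|i j| |p IHp q IHq|p IH]; intros r e; simpl; try tauto.
- rewrite IHp, IHq; tauto.
- split; intros H a Ha; specialize (H a Ha); rewrite IH in *;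
    match goal with K : zsat _ ?f _ |- zsat _ ?g _ => replace g with f end;
    auto; apply functional_extensionality; intros [|n]; reflexivity.
Qed.

(** A free variable of a formula is assigned a variable of the ambient environment
    ([inl]) or a parameter ([inr]). *)
Definition assign (v : nat -> nat + set) (e : nat -> set) (n : nat) : set :=
  match v n with inl j => e j | inr c => c end.

Definition params_in (W : set) (v : nat -> nat + set) : Prop :=
  forall n c, v n = inr c -> c ∈ W.

Definition env_in (W : set) (e : nat -> set) : Prop := forall n, e n ∈ W.

Definition zdefinable (W : set) (P : (nat -> set) -> Prop) : Prop :=
  exists p v, params_in W v /\
    forall e, env_in W e -> (zsat W (assign v e) p <-> P e).

Definition zterm (W : set) (t : (nat -> set) -> set) : Prop :=
  (forall e, env_in W e -> t e ∈ W) /\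
  zdefinable W (fun e => e 0 = t (fun n => e (S n))).

Lemma assign_in W v e : params_in W v -> env_in W e -> env_in W (assign v e).
Proof.
intros Hv He n; unfold assign; destruct (v n) as [j|c] eqn:E; [apply He | exact (Hv n c E)].
Qed.

Lemma scons_in W a e : a ∈ W -> env_in W e -> env_in W (scons a e).
Proof. intros Ha He [|n]; simpl; auto. Qed.

Lemma zdef_ext W P Q : (forall e, env_in W e -> (P e <-> Q e)) ->
  zdefinable W P -> zdefinable W Q.
Proof.
intros H [p [v [Hv Hp]]]; exists p, v; split; [exact Hv|].
intros e He; rewrite (Hp e He); apply H, He.
Qed.

Lemma zdef_ren W r P : zdefinable W P -> zdefinable W (fun e => P (fun n => e (r n))).
Proof.
intros [p [v [Hv Hp]]].
exists p, (fun n => match v n with inl j => inl (r j) | inr c => inr c end); split.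
- intros n c; destruct (v n) as [|c'] eqn:E; [discriminate|].
  intros K; injection K as <-; exact (Hv n c' E).
- intros e He; rewrite <- Hp by (intros n; apply He).
  replace (assign v _) with
    (assign (fun n => match v n with inl j => inl (r j) | inr c => inr c end) e); [tauto|].
  apply functional_extensionality; intros n; unfold assign; destruct (v n); reflexivity.
Qed.

Lemma zdef_False W : zdefinable W (fun _ => False).
Proof. exists zBot, (fun n => inl n); split; [discriminate | reflexivity]. Qed.

Lemma zdef_imp W P Q :
  zdefinable W P -> zdefinable W Q -> zdefinable W (fun e => P e -> Q e).
Proof.
intros [p [v [Hv Hp]]] [q [w [Hw Hq]]].
(* The two formulas come with separate assignments, which are interleaved: even variables serve p,
   odd ones serve q. *)
pose (u := fun n => if Nat.even n then v (Nat.div2 n) else w (Nat.div2 n)).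
exists (zImp (zren (fun n => 2 * n) p) (zren (fun n => S (2 * n)) q)), u; split.
- intros n c; unfold u; destruct (Nat.even n); [apply Hv | apply Hw].
- intros e He; cbn [zsat]; rewrite !zsat_zren, <- (Hp e He), <- (Hq e He).
  replace (fun n => assign u e (2 * n)) with (assign v e).
  2:{ apply functional_extensionality; intros n; unfold assign, u.
      rewrite Nat.even_mul, Nat.div2_double; reflexivity. }
  replace (fun n => assign u e (S (2 * n))) with (assign w e); [tauto|].
  apply functional_extensionality; intros n; unfold assign, u.
  rewrite Nat.even_succ, Nat.odd_mul, Nat.div2_succ_double; reflexivity.
Qed.

(** Brings the formula to the shape that [zAll] and separation expect, with the distinguished
    element at index 0. Several variables may be assigned the ambient variable 0; all of them are
    renamed to 0, and the others are shifted by one. *)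
Lemma zdef_scons W (R : (nat -> set) -> set -> Prop) :
  zdefinable W (fun e => R (fun n => e (S n)) (e 0)) ->
  exists p v, params_in W v /\ forall e a, env_in W e -> a ∈ W ->
    (zsat W (scons a (assign v e)) p <-> R e a).
Proof.
intros [p [v [Hv Hp]]].
exists (zren (fun n => match v n with inl 0 => 0 | _ => S n end) p),
  (fun n => match v n with inl (S j) => inl j | x => x end); split.
- intros n c; destruct (v n) as [[|j]|c'] eqn:E; try discriminate.
  intros K; injection K as <-; exact (Hv n c' E).
- intros e a He Ha; rewrite zsat_zren, <- (Hp (scons a e)) by (apply scons_in; assumption).
  match goal with |- zsat _ ?f _ <-> zsat _ ?g _ => replace g with f; [tauto|] end.
  apply functional_extensionality; intros n; unfold assign.
  destruct (v n) as [[|j]|c] eqn:E; simpl; rewrite ?E; reflexivity.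
Qed.

Lemma zdef_all W (R : (nat -> set) -> set -> Prop) :
  zdefinable W (fun e => R (fun n => e (S n)) (e 0)) ->
  zdefinable W (fun e => forall x, x ∈ W -> R e x).
Proof.
intros H; destruct (zdef_scons W R H) as [p [v [Hv Hp]]].
exists (zAll p), v; split; [exact Hv|]; intros e He; simpl.
split; intros K a Ha; apply (Hp e a He Ha), K, Ha.
Qed.

Lemma zdef_not W P : zdefinable W P -> zdefinable W (fun e => ~ P e).
Proof. intros H; exact (zdef_imp W _ _ H (zdef_False W)). Qed.

Lemma zdef_or W P Q :
  zdefinable W P -> zdefinable W Q -> zdefinable W (fun e => P e \/ Q e).
Proof.
intros HP HQ; eapply zdef_ext; [|exact (zdef_imp W _ _ (zdef_not W _ HP) HQ)].
intros e _; simpl; tauto.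
Qed.

Lemma zdef_and W P Q :
  zdefinable W P -> zdefinable W Q -> zdefinable W (fun e => P e /\ Q e).
Proof.
intros HP HQ; eapply zdef_ext;
  [|exact (zdef_not W _ (zdef_imp W _ _ HP (zdef_not W _ HQ)))].
intros e _; simpl; tauto.
Qed.

Lemma zdef_iff W P Q :
  zdefinable W P -> zdefinable W Q -> zdefinable W (fun e => P e <-> Q e).
Proof. intros HP HQ; apply (zdef_and W); apply zdef_imp; assumption. Qed.

Lemma zdef_ex W (R : (nat -> set) -> set -> Prop) :
  zdefinable W (fun e => R (fun n => e (S n)) (e 0)) ->
  zdefinable W (fun e => exists x, x ∈ W /\ R e x).
Proof.
intros H; eapply zdef_ext;
  [|exact (zdef_not W _ (zdef_all W (fun e x => ~ R e x) (zdef_not W _ H)))].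
intros e _; simpl; split.
- intros K; apply NNPP; intros N; apply K; intros x Hx Hr; apply N; eauto.
- intros [x [Hx Hr]] K; exact (K x Hx Hr).
Qed.

Lemma zterm_shift W t : zterm W t -> zterm W (fun e => t (fun n => e (S n))).
Proof.
intros [H K]; split; [intros e He; apply H; intros n; apply He|].
exact (zdef_ren W (fun n => match n with O => O | S k => S (S k) end) _ K).
Qed.

Lemma zdef_subst W t (R : (nat -> set) -> set -> Prop) :
  zterm W t -> zdefinable W (fun e => R (fun n => e (S n)) (e 0)) ->
  zdefinable W (fun e => R e (t e)).
Proof.
intros [Ht Kt] H; eapply zdef_ext;
  [|exact (zdef_ex W (fun e x => x = t e /\ R e x) (zdef_and W _ _ Kt H))].
intros e He; simpl; split.
- intros [x [_ [-> K]]]; exact K.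
- intros K; exists (t e); auto.
Qed.

Lemma zterm_var W i : zterm W (fun e => e i).
Proof.
split; [intros e He; apply He|].
exists (zEq 0 1), (fun n => match n with O => inl 0 | _ => inl (S i) end); split.
- intros [|n] c; discriminate.
- intros e He; simpl; tauto.
Qed.

Lemma zterm_const W c : c ∈ W -> zterm W (fun _ => c).
Proof.
intros Hc; split; [intros e He; exact Hc|].
exists (zEq 0 1), (fun n => match n with O => inl 0 | _ => inr c end); split.
- intros [|n] d; [discriminate|]; intros K; injection K as <-; exact Hc.
- intros e He; simpl; tauto.
Qed.

Lemma zdef_eq W s t : zterm W s -> zterm W t -> zdefinable W (fun e => s e = t e).
Proof. intros Hs Ht; exact (zdef_subst W s (fun e x => x = t e) Hs (proj2 Ht)). Qed.

Lemma zdef_mem W s t : zterm W s -> zterm W t -> zdefinable W (fun e => s e ∈ t e).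
Proof.
intros Hs Ht; apply (zdef_subst W s (fun e x => x ∈ t e) Hs).
apply (zdef_subst W _ (fun e y => e 0 ∈ y) (zterm_shift W t Ht)).
exists (zIn 1 0), (fun n => inl n); split; [discriminate | reflexivity].
Qed.

(** Transitivity puts the elements of s e into [W], so a bounded quantifier agrees with its
    relativization. *)
Lemma zdef_ball W s (R : (nat -> set) -> set -> Prop) : transitive W ->
  zterm W s -> zdefinable W (fun e => R (fun n => e (S n)) (e 0)) ->
  zdefinable W (fun e => forall x, x ∈ s e -> R e x).
Proof.
intros HW Hs H; eapply zdef_ext; [|apply (zdef_all W (fun e x => x ∈ s e -> R e x))].
- intros e He; simpl; split; [|auto].
  intros K x Hx; apply K; [exact (HW _ (proj1 Hs e He) x Hx) | exact Hx].
- apply zdef_imp; [|exact H].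
  apply zdef_mem; [apply zterm_var | apply zterm_shift, Hs].
Qed.

Lemma zdef_bex W s (R : (nat -> set) -> set -> Prop) : transitive W ->
  zterm W s -> zdefinable W (fun e => R (fun n => e (S n)) (e 0)) ->
  zdefinable W (fun e => exists x, x ∈ s e /\ R e x).
Proof.
intros HW Hs H; eapply zdef_ext; [|apply (zdef_ex W (fun e x => x ∈ s e /\ R e x))].
- intros e He; simpl; split.
  + intros [x [_ K]]; exists x; exact K.
  + intros [x [Hx K]]; exists x; split; [exact (HW _ (proj1 Hs e He) x Hx) | auto].
- apply zdef_and; [|exact H].
  apply zdef_mem; [apply zterm_var | apply zterm_shift, Hs].
Qed.

(** By transitivity the subset that separation yields inside [W] has the same elements as the actual
    one. Most memberships in a model are proved by writing the set as such a subset. *)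
Lemma sep_in W (P : set -> Prop) x : transitive_model W ->
  zdefinable W (fun e => P (e 0)) -> x ∈ W -> sep P x ∈ W.
Proof.
intros [HW HZ] HP Hx; destruct (zdef_scons W (fun _ a => P a) HP) as [p [v [Hv Hp]]].
assert (He : env_in W (fun _ => x)) by (intros n; exact Hx).
destruct (zfc_separation W HZ p (assign v (fun _ => x)) x) as [y [Hy K]]; auto.
{ apply assign_in; assumption. }
replace (sep P x) with y; [exact Hy|].
apply set_ext; intros z; rewrite mem_sep; split.
- intros Hz; assert (z ∈ W) by exact (HW y Hy z Hz).
  apply K in Hz as [Hz Hs]; [|assumption]; split; [exact Hz|].
  apply (Hp (fun _ => x)) in Hs; assumption.
- intros [Hz Hs]; assert (z ∈ W) by exact (HW x Hx z Hz).
  apply K; [assumption|]; split; [exact Hz|]; apply (Hp (fun _ => x)); assumption.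
Qed.

Lemma upair_in W x y : transitive_model W -> x ∈ W -> y ∈ W -> upair x y ∈ W.
Proof.
intros [HW HZ] Hx Hy; destruct (zfc_pairing W HZ x y Hx Hy) as [p [Hp K]].
replace (upair x y) with p; [exact Hp|].
apply set_ext; intros z; rewrite mem_upair; split; intros Hz.
- apply K; [exact (HW p Hp z Hz) | exact Hz].
- apply K; [|exact Hz]; destruct Hz as [->| ->]; assumption.
Qed.

Lemma opair_in W x y : transitive_model W -> x ∈ W -> y ∈ W -> opair x y ∈ W.
Proof. intros HW Hx Hy; apply upair_in; [|apply upair_in..]; assumption. Qed.

Lemma opair_in_inv W x y : transitive W -> opair x y ∈ W -> x ∈ W /\ y ∈ W.
Proof.
intros HW H; assert (K : upair x y ∈ W).
{ apply (HW _ H), mem_upair; auto. }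
split; apply (HW _ K), mem_upair; auto.
Qed.

Lemma union_in W x y : transitive_model W -> x ∈ W -> y ∈ W ->
  exists u, u ∈ W /\ forall z, z ∈ u <-> z ∈ x \/ z ∈ y.
Proof.
intros HM Hx Hy; destruct (zfc_union W (proj2 HM) (upair x y)) as [u [Hu K]].
{ apply upair_in; assumption. }
destruct HM as [HW HZ]; exists u; split; [exact Hu|]; intros z; split.
- intros Hz; apply K in Hz as [w [_ [Hw Hz]]]; [|exact (HW u Hu z Hz)].
  apply mem_upair in Hw as [->| ->]; auto.
- intros [Hz|Hz].
  + apply K; [exact (HW x Hx z Hz)|].
    exists x; split; [exact Hx|]; split; [apply mem_upair; auto | exact Hz].
  + apply K; [exact (HW y Hy z Hz)|].
    exists y; split; [exact Hy|]; split; [apply mem_upair; auto | exact Hz].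
Qed.

(** This is the power set as [W] sees it, so a subset of x must be shown to lie in [W] before it
    counts. *)
Lemma power_in W x : transitive_model W -> x ∈ W ->
  exists u, u ∈ W /\ forall z, z ∈ u <-> z ∈ W /\ z ⊆ x.
Proof.
intros [HW HZ] Hx; destruct (zfc_power W HZ x Hx) as [u [Hu K]].
exists u; split; [exact Hu|]; intros z; split.
- intros Hz; assert (Hz' := HW u Hu z Hz); split; [exact Hz'|].
  intros w Hw; apply (K z Hz'); auto; exact (HW z Hz' w Hw).
- intros [Hz H]; apply K; [exact Hz|]; intros w _; apply H.
Qed.

Lemma zterm_upair W s t : transitive_model W ->
  zterm W s -> zterm W t -> zterm W (fun e => upair (s e) (t e)).
Proof.
intros HM Hs Ht; split.
- intros e He; apply upair_in; [exact HM | apply Hs, He | apply Ht, He].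
- eapply zdef_ext; [|apply (zdef_all W (fun e x => x ∈ e 0 <->
    x = s (fun n => e (S n)) \/ x = t (fun n => e (S n))))].
  + intros e He; simpl; split; [intros K; apply set_ext; intros z | intros -> z _].
    * rewrite mem_upair; split; intros Hz.
      -- apply K; [exact (proj1 HM _ (He 0) z Hz) | exact Hz].
      -- apply K; [|exact Hz].
         destruct Hz as [->| ->]; [apply Hs | apply Ht]; intros n; apply He.
    * apply mem_upair.
  + apply zdef_iff; [apply zdef_mem; apply zterm_var|].
    apply zdef_or; (apply zdef_eq; [apply zterm_var|]).
    * exact (zterm_shift W _ (zterm_shift W s Hs)).
    * exact (zterm_shift W _ (zterm_shift W t Ht)).
Qed.

Lemma zterm_opair W s t : transitive_model W ->
  zterm W s -> zterm W t -> zterm W (fun e => opair (s e) (t e)).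
Proof.
intros HM Hs Ht; apply (zterm_upair W (fun e => upair (s e) (s e))
  (fun e => upair (s e) (t e)) HM); apply zterm_upair; assumption.
Qed.

(** A term that is neither a variable nor a pair is taken as a parameter, whose membership in the
    model is sought in the context. This is why [arith_in] is destructed before calls that mention
    the components of [M]. *)
Ltac z_tac := cbv beta; lazymatch goal with
  | |- zterm _ (fun e => e _) => apply zterm_var
  | |- zterm _ (fun e => opair _ _) => apply zterm_opair; [assumption | z_tac | z_tac]
  | |- zterm _ (fun e => _) => apply zterm_const; assumption
  | |- zdefinable _ (fun e => _ /\ _) => apply zdef_and; z_tac
  | |- zdefinable _ (fun e => _ \/ _) => apply zdef_or; z_tac
  | |- zdefinable _ (fun e => _ <-> _) => apply zdef_iff; z_tac
  | |- zdefinable _ (fun e => _ = _) => apply zdef_eq; z_tac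
  | |- zdefinable _ (fun e => _ ∈ _) => apply zdef_mem; z_tac
  | |- zdefinable ?W (fun e => exists x, x ∈ ?W /\ _) => apply zdef_ex; z_tac
  | |- zdefinable ?W (fun e => exists x, _) =>
    apply zdef_bex; [match goal with H : transitive_model W |- _ => apply H end | z_tac | z_tac]
  | |- zdefinable ?W (fun e => forall x, x ∈ ?W -> _) => apply zdef_all; z_tac
  | |- zdefinable ?W _ => first
    [ apply zdef_imp; [z_tac | z_tac]
    | apply zdef_ball;
        [match goal with H : transitive_model W |- _ => apply H end | z_tac | z_tac] ]
  end.

(** A Kuratowski pair from the product lies in the second power set of x ∪ y, from which separation
    carves the product. *)
Lemma cprod_in W x y : transitive_model W -> x ∈ W -> y ∈ W -> cprod x y ∈ W.
Proof.
intros HM Hx Hy; destruct (union_in W x y HM Hx Hy) as [u [Hu U]].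
destruct (power_in W u HM Hu) as [v [Hv P]], (power_in W v HM Hv) as [w [Hw Q]].
replace (cprod x y) with (sep (fun z => exists a, a ∈ x /\ exists b, b ∈ y /\ z = opair a b) w).
{ apply sep_in; [exact HM | z_tac | exact Hw]. }
apply set_ext; intros z; rewrite mem_sep, mem_cprod; split.
- intros [_ [a [Ha [b [Hb ->]]]]]; exists a, b; auto.
- intros [a [b [Ha [Hb ->]]]]; split; [|exists a; split; [exact Ha|]; exists b; auto].
  assert (Ha' := proj1 HM x Hx a Ha); assert (Hb' := proj1 HM y Hy b Hb).
  apply Q; split; [apply opair_in; assumption|].
  intros s Hs; apply P.
  apply mem_upair in Hs as [->| ->]; (split; [apply upair_in; assumption|]);
    intros r Hr; apply mem_upair in Hr as [->| ->]; apply U; auto.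
Qed.

(** ** Coded sets and functions in a transitive model *)

Definition arith_in (W : set) (M : arith) : Prop :=
  car M ∈ W /\ zero M ∈ W /\ one M ∈ W /\ add M ∈ W /\ mul M ∈ W /\ lt_rel M ∈ W.

Lemma arith_set_in W M : transitive W -> arith_set M ∈ W -> arith_in W M.
Proof.
intros HW H; unfold arith_set in H; unfold arith_in.
repeat (apply opair_in_inv in H as [? H]; [|exact HW]); auto 8.
Qed.

(** The graph of [beta], with every value of an operation of [M] named by a bounded
    quantifier. *)
Definition beta_rel (M : arith) (a b x y : set) : Prop :=
  exists u, u ∈ car M /\ opair (opair x (one M)) u ∈ add M /\
  exists v, v ∈ car M /\ opair (opair u b) v ∈ mul M /\
  exists m, m ∈ car M /\ opair (opair (one M) v) m ∈ add M /\ opair y m ∈ lt_rel M /\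
  exists q, q ∈ car M /\ exists r, r ∈ car M /\ opair (opair q m) r ∈ mul M /\
    opair (opair r y) a ∈ add M.

Lemma beta_rel_iff M a b x y : is_arith M -> a ∈ car M -> b ∈ car M -> x ∈ car M ->
  y ∈ car M -> beta_rel M a b x y <-> beta M a b x y.
Proof.
intros HM Ha Hb Hx Hy; assert (H1 : one M ∈ car M) by apply HM.
assert (Hu := plus_car M x _ HM Hx H1); assert (Hv := times_car M _ b HM Hu Hb).
assert (Hm := plus_car M _ _ HM H1 Hv); unfold beta_rel; split.
- intros [u [_ [Eu [v [_ [Ev [m [_ [Em [L [q [Hq [r [_ [Er E]]]]]]]]]]]]]]].
  apply (add_graph M _ _ _ HM) in Eu as [_ [_ <-]].
  apply (mul_graph M _ _ _ HM) in Ev as [_ [_ <-]].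
  apply (add_graph M _ _ _ HM) in Em as [_ [_ <-]].
  apply (mul_graph M _ _ _ HM) in Er as [_ [_ <-]].
  apply (add_graph M _ _ _ HM) in E as [_ [_ <-]].
  split; [exact L|]; exists q; split; [exact Hq | reflexivity].
- intros [L [q [Hq E]]].
  assert (Hr := times_car M q _ HM Hq Hm).
  exists (plus M x (one M)); split; [exact Hu|]; split; [apply add_graph; auto|].
  exists (times M (plus M x (one M)) b); split; [exact Hv|].
  split; [apply mul_graph; auto|].
  exists (beta_modulus M b x); split; [exact Hm|]; split; [apply add_graph; auto|].
  split; [exact L|]; exists q; split; [exact Hq|].
  exists (times M q (beta_modulus M b x)); split; [exact Hr|].
  split; [apply mul_graph; auto | apply add_graph; auto].
Qed.

Lemma seg_in W M n : transitive_model W -> arith_in W M -> n ∈ W -> seg M n ∈ W.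
Proof.
intros HW [Hc [_ [_ [_ [_ Hl]]]]] Hn; unfold seg, less.
apply sep_in; [exact HW | z_tac | exact Hc].
Qed.

Lemma car_subset W M : transitive W -> arith_in W M -> car M ⊆ W.
Proof. intros HW [Hc _] x Hx; exact (HW _ Hc x Hx). Qed.

(** The code of A defines it over [M] in any transitive model that contains [M]. *)
Lemma coded_set_in W M n A : transitive_model W -> is_arith M -> arith_in W M ->
  n ∈ car M -> coded_set M n A -> A ∈ W.
Proof.
intros HW HM HI Hn [HA [p [q [Hp [Hq H]]]]].
assert (S := car_subset W M (proj1 HW) HI).
pose proof (seg_in W M n HW HI (S n Hn)) as Hs.
assert (Hp' := S p Hp); assert (Hq' := S q Hq).
replace A with (sep (fun x => beta_rel M p q x (zero M)) (seg M n)).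
{ destruct HI as [? [? [? [? [? ?]]]]].
  apply sep_in; [exact HW | unfold beta_rel; z_tac | exact Hs]. }
apply set_ext; intros x; rewrite mem_sep; split.
- intros [Hx K]; apply H; [exact Hx|]; apply mem_seg in Hx as [Hx _].
  apply beta_rel_iff in K; try assumption; apply HM.
- intros Hx; assert (Hx' := HA x Hx); split; [exact Hx'|].
  apply H in Hx; [|exact Hx']; apply mem_seg in Hx' as [Hx' _].
  apply beta_rel_iff; try assumption; apply HM.
Qed.

Lemma graph_in W M c d n : transitive_model W -> is_arith M -> arith_in W M ->
  c ∈ car M -> d ∈ car M -> n ∈ car M -> graph M c d n ∈ W.
Proof.
intros HW HM HI Hc Hd Hn; assert (S := car_subset W M (proj1 HW) HI).
pose proof (seg_in W M n HW HI (S n Hn)) as Hs.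
pose proof (cprod_in W _ _ HW Hs (proj1 HI)) as Hp.
assert (Hc' := S c Hc); assert (Hd' := S d Hd).
replace (graph M c d n) with (sep (fun z => exists x, x ∈ seg M n /\ exists y, y ∈ car M /\
  z = opair x y /\ beta_rel M c d x y) (cprod (seg M n) (car M))).
{ destruct HI as [? [? [? [? [? ?]]]]].
  apply sep_in; [exact HW | unfold beta_rel; z_tac | exact Hp]. }
apply set_ext; intros z; unfold graph; rewrite !mem_sep; split.
- intros [Hz [x [Hx [y [Hy [-> B]]]]]]; split; [exact Hz|]; exists x, y.
  apply mem_seg in Hx as [Hx _]; apply beta_rel_iff in B; auto.
- intros [Hz [x [y [-> B]]]]; split; [exact Hz|].
  apply opair_cprod in Hz as [Hx Hy]; exists x; split; [exact Hx|].
  exists y; split; [exact Hy|]; split; [reflexivity|].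
  apply mem_seg in Hx as [Hx _]; apply beta_rel_iff; auto.
Qed.

(** ** Recovering [G] from the class of the identity *)

(** Stated through the graph, which an ∈-formula can express directly, rather than through [ap], a
    choice operator. *)
Definition fixed_points (M : arith) (Om f : set) : set :=
  sep (fun x => opair x x ∈ f) (seg M Om).

Lemma RV_iff M Om f : true_arithmetic M ->
  f ∈ RV M Om <-> exists c d, c ∈ car M /\ d ∈ car M /\ f = graph M c d Om.
Proof.
intros HM; rewrite <- (coded_fun_iff M Om f HM); unfold RV.
rewrite mem_sep, mem_power; split; [tauto|]; intros H; split; [apply H | exact H].
Qed.

Lemma rv_class_id M Om G f :
  f ∈ rv_class M Om G (id_rv M Om) <-> f ∈ RV M Om /\ fixed_points M Om f ∈ G.
Proof.
unfold rv_class; rewrite mem_sep.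
enough (H : f ∈ RV M Om -> sep (fun x => ap (id_rv M Om) x = ap f x) (seg M Om) =
  fixed_points M Om f).
{ split; intros [Hf K]; specialize (H Hf); [rewrite <- H | rewrite H]; auto. }
intros Hf; unfold RV in Hf; apply mem_sep in Hf as [_ [Hf _]].
assert (I : is_fun (id_rv M Om) (seg M Om) (seg M Om)).
{ unfold id_rv; split.
  - intros z Hz; apply mem_image in Hz as [x [Hx ->]]; apply opair_cprod; auto.
  - intros x Hx; exists x; split; [apply mem_image; exists x; auto|].
    intros y Hy; apply mem_image in Hy as [z [_ E]]; apply opair_inj in E; intuition congruence. }
apply set_ext; intros x; unfold fixed_points; rewrite !mem_sep.
enough (K : x ∈ seg M Om -> ap (id_rv M Om) x = x).
{ split; intros [Hx E]; (split; [exact Hx|]); specialize (K Hx).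
  - rewrite K in E; rewrite E at 2; exact (opair_ap _ _ _ _ Hf Hx).
  - rewrite K; symmetry; exact (ap_eq _ _ _ _ _ Hf E). }
intros Hx; apply (ap_eq _ _ _ _ _ I); apply mem_image; exists x; auto.
Qed.

Lemma coded_set_fixed_points M Om A : true_arithmetic M -> Om ∈ car M ->
  coded_set M Om A -> exists f, f ∈ RV M Om /\ fixed_points M Om f = A.
Proof.
intros HM HO [HA [p [q [Hp [Hq H]]]]].
destruct (fixing_code M p q Om HM Hp Hq HO) as [a [Ha [b [Hb K]]]].
exists (graph M a b Om); split; [apply RV_iff; [assumption|]; exists a, b; auto|].
apply set_ext; intros x; unfold fixed_points; rewrite mem_sep, opair_graph; split.
- intros [Hx [_ [Hx' B]]]; apply H; [exact Hx|].
  apply mem_seg in Hx as [_ L]; apply NNPP; intros N.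
  apply (plus_one_neq M x HM Hx').
  apply (beta_unique M a b x); try assumption.
  + apply plus_car; [apply HM | exact Hx' | apply HM].
  + apply K; assumption.
- intros Hx; assert (Hx' := HA x Hx); split; [exact Hx'|]; split; [exact Hx'|].
  apply H in Hx; [|exact Hx']; apply mem_seg in Hx' as [Hx' L].
  split; [exact Hx'|]; apply K; assumption.
Qed.

Lemma Aplus_coded M Om A : A ∈ Aplus M Om -> coded_set M Om A.
Proof. intros H; unfold Aplus, Acal in H; rewrite !mem_sep in H; apply H. Qed.

Lemma rv_class_id_in W M Om G : transitive_model W -> true_arithmetic M ->
  arith_in W M -> Om ∈ car M -> G ∈ W -> rv_class M Om G (id_rv M Om) ∈ W.
Proof.
intros HW HM HI HO HG; assert (S := car_subset W M (proj1 HW) HI).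
pose proof (seg_in W M Om HW HI (S Om HO)) as Hs.
pose proof (cprod_in W _ _ HW Hs (proj1 HI)) as Hp.
destruct (power_in W _ HW Hp) as [u [Hu U]].
(* Being a random variable is expressed by a code, and having its fixed points in [G] by some A in
   [G] with the same elements, so that every quantifier is bounded by a set of [W]. *)
replace (rv_class M Om G (id_rv M Om)) with
  (sep (fun f => (exists c, c ∈ car M /\ exists d, d ∈ car M /\
     forall x, x ∈ seg M Om -> forall y, y ∈ car M ->
       (opair x y ∈ f <-> beta_rel M c d x y)) /\
     exists A, A ∈ G /\ (forall x, x ∈ A -> x ∈ seg M Om) /\
       forall x, x ∈ seg M Om -> (x ∈ A <-> opair x x ∈ f)) u).
{ destruct HI as [? [? [? [? [? ?]]]]].
  apply sep_in; [exact HW | unfold beta_rel; z_tac | exact Hu]. }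
apply set_ext; intros f; rewrite mem_sep, rv_class_id, (RV_iff M Om f HM), U.
assert (F : (exists A, A ∈ G /\ (forall x, x ∈ A -> x ∈ seg M Om) /\
  forall x, x ∈ seg M Om -> (x ∈ A <-> opair x x ∈ f)) <-> fixed_points M Om f ∈ G).
{ unfold fixed_points; split.
  - intros [A [HA [HA' K]]]; replace (sep _ _) with A; [exact HA|].
    apply set_ext; intros x; rewrite mem_sep; split.
    + intros Hx; split; [exact (HA' x Hx) | apply K; auto].
    + intros [Hx L]; apply K; assumption.
  - intros K; eexists; split; [exact K|]; split; intros x Hx.
    + apply mem_sep in Hx; apply Hx.
    + rewrite mem_sep; tauto. }
rewrite F; split; intros [H1 H2].
- destruct H2 as [[c [Hc [d [Hd K]]]] H2]; split; [|exact H2].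
  exists c, d; split; [exact Hc|]; split; [exact Hd|].
  apply (cprod_subset_ext _ _ (seg M Om) (car M)); [apply H1 | |].
  { apply graph_is_fun; assumption. }
  intros x y; rewrite opair_graph; split.
  + intros L; destruct (proj1 (opair_cprod _ _ _ _) (proj2 H1 _ L)) as [Hx Hy].
    split; [exact Hx|]; split; [exact Hy|].
    apply (K x Hx y Hy) in L; apply mem_seg in Hx as [Hx _].
    apply beta_rel_iff in L; try assumption; apply HM.
  + intros [Hx [Hy B]]; apply (K x Hx y Hy); apply mem_seg in Hx as [Hx _].
    apply beta_rel_iff; try assumption; apply HM.
- destruct H1 as [c [d [Hc [Hd ->]]]]; split; [split|split; [|exact H2]].
  + apply graph_in; try assumption; apply HM.
  + apply graph_is_fun; assumption.
  + exists c; split; [exact Hc|]; exists d; split; [exact Hd|].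
    intros x Hx y Hy; rewrite opair_graph.
    pose proof (proj1 (proj1 (mem_seg _ _ _) Hx)) as Hx'.
    rewrite (beta_rel_iff M c d x y (proj1 HM) Hc Hd Hx' Hy); tauto.
Qed.

Lemma generic_in W M Om G : transitive_model W -> true_arithmetic M ->
  arith_in W M -> Om ∈ car M -> G ⊆ Aplus M Om ->
  rv_class M Om G (id_rv M Om) ∈ W -> G ∈ W.
Proof.
intros HW HM HI HO HG HC; assert (S := car_subset W M (proj1 HW) HI).
pose proof (seg_in W M Om HW HI (S Om HO)) as Hs.
destruct (power_in W _ HW Hs) as [u [Hu U]].
replace G with (sep (fun A => exists f, f ∈ rv_class M Om G (id_rv M Om) /\
  forall x, x ∈ seg M Om -> (x ∈ A <-> opair x x ∈ f)) u).
{ apply sep_in; [exact HW | z_tac | exact Hu]. }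
apply set_ext; intros A; rewrite mem_sep, U; split.
- intros [[_ HA] [f [Hf K]]]; apply rv_class_id in Hf as [_ Hf].
  replace A with (fixed_points M Om f); [exact Hf|].
  apply set_ext; intros x; unfold fixed_points; rewrite mem_sep; split.
  + intros [Hx L]; apply K; assumption.
  + intros Hx; assert (Hx' := HA x Hx); split; [exact Hx' | apply K; assumption].
(* An element of [G] is coded, which both puts it into [W], hence into u, and makes it the set of
   fixed points of a random variable. *)
- intros HA; assert (HA' := Aplus_coded _ _ _ (HG A HA)); split; [split|].
  + apply (coded_set_in W M Om); try assumption; apply HM.
  + apply HA'.
  + destruct (coded_set_fixed_points M Om A HM HO HA') as [f [Hf <-]].
    exists f; split; [apply rv_class_id; auto|].
    intros x Hx; unfold fixed_points; rewrite mem_sep; tauto.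
Qed.

(** ** The generic filter is not in the ground model *)

(** Every [(k, y)] in a derivation has [y] a standard multiple of [a], by ∈-induction
    on [k]; this puts the standard multiples of [a] within reach of separation. *)
Definition derivation (V : set) (M : arith) (a g : set) : Prop :=
  forall k, k ∈ V -> forall y, y ∈ car M -> opair k y ∈ g ->
    y = zero M \/ exists j, j ∈ k /\ exists z, z ∈ car M /\
      opair j z ∈ g /\ opair (opair z a) y ∈ add M.

Lemma derivation_multiple V M a g : transitive V -> is_arith M -> derivation V M a g ->
  forall k, k ∈ V -> forall y, y ∈ car M -> opair k y ∈ g -> exists n, y = nmul M n a.
Proof.
intros HV HM Hg k; induction k as [k IH] using (well_founded_ind mem_wf).
intros Hk y Hy H; destruct (Hg k Hk y Hy H) as [->|[j [Hj [z [Hz [K E]]]]]].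
- exists 0; reflexivity.
- destruct (IH j Hj (HV k Hk j Hj) z Hz K) as [n ->]; exists (S n).
  apply (add_graph M _ _ _ HM) in E as [_ [_ <-]]; reflexivity.
Qed.

(** The keys only have to increase along ∈, so iterated singletons serve as counters: the step from
    k to {k} adds one more summand a. The first key, [zero M], is an element of [V] at hand. *)
Lemma multiple_derivation V M a n : transitive_model V -> is_arith M -> arith_in V M ->
  a ∈ car M -> exists g, g ∈ V /\ derivation V M a g /\
    exists k, k ∈ V /\ opair k (nmul M n a) ∈ g.
Proof.
intros HV HM HI Ha; induction n as [|n [g [Hg [D [k [Hk K]]]]]].
- assert (Hz : zero M ∈ V) by apply HI.
  exists (upair (opair (zero M) (zero M)) (opair (zero M) (zero M))).
  split; [apply upair_in; [|apply opair_in..]; assumption|]; split.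
  + intros k _ y _ H; apply mem_upair in H as [E|E]; apply opair_inj in E; left; apply E.
  + exists (zero M); split; [exact Hz | apply mem_upair; left; reflexivity].
- assert (Hn := nmul_car M n a HM Ha); assert (Hy := nmul_car M (S n) a HM Ha).
  assert (Hk' : upair k k ∈ V) by (apply upair_in; assumption).
  assert (Hp : opair (upair k k) (nmul M (S n) a) ∈ V).
  { apply opair_in; [exact HV | exact Hk' |].
    exact (car_subset V M (proj1 HV) HI _ Hy). }
  destruct (union_in V g (upair (opair (upair k k) (nmul M (S n) a))
    (opair (upair k k) (nmul M (S n) a))) HV Hg) as [g' [Hg' U]].
  { apply upair_in; assumption. }
  exists g'; split; [exact Hg'|]; split.
  + intros j Hj y Hy' H; apply U in H as [H|H].
    * destruct (D j Hj y Hy' H) as [->|[i [Hi [z [Hz [L E]]]]]]; [left; reflexivity|].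
      right; exists i; split; [exact Hi|]; exists z; split; [exact Hz|].
      split; [apply U; left; exact L | exact E].
    * assert (E : opair j y = opair (upair k k) (nmul M (S n) a)).
      { apply mem_upair in H as [E|E]; exact E. }
      apply opair_inj in E as [-> ->]; right; exists k.
      split; [apply mem_upair; left; reflexivity|].
      exists (nmul M n a); split; [exact Hn|]; split; [apply U; left; exact K|].
      apply (add_graph M _ _ _ HM); split; [exact Hn|]; split; [exact Ha | reflexivity].
  + exists (upair k k); split; [exact Hk'|]; apply U; right; apply mem_upair; left.
    reflexivity.
Qed.

(** After [Aplus_iff], the standard n is the only thing that has no ∈-formula yet. It is replaced by
    a derivation in [V] that reaches some y ≥ [Om]; well-foundedness of ∈ guarantees that this y is
    a standard multiple. *)
Lemma Aplus_in V M Om : transitive_model V -> true_arithmetic M -> arith_in V M ->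
  Om ∈ car M -> less M (zero M) Om -> Aplus M Om ∈ V.
Proof.
intros HV HM HI HO H0; assert (S := car_subset V M (proj1 HV) HI).
assert (HO' := S Om HO); pose proof (seg_in V M Om HV HI HO') as Hs.
destruct (power_in V _ HV Hs) as [u [Hu U]].
(* This is the right-hand side of [mcard_iff] with [beta_rel] for [beta], hence readable by
   [z_tac]. *)
pose (card := fun A a => exists c, c ∈ car M /\ exists d, d ∈ car M /\
  (forall x, x ∈ car M -> forall x', x' ∈ car M -> forall y, y ∈ car M ->
    opair x a ∈ lt_rel M -> opair x' a ∈ lt_rel M ->
    beta_rel M c d x y -> beta_rel M c d x' y -> x = x') /\
  forall y, y ∈ car M -> (y ∈ A <->
    exists x, x ∈ car M /\ opair x a ∈ lt_rel M /\ beta_rel M c d x y)).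
replace (Aplus M Om) with (sep (fun A => exists a, a ∈ car M /\ card A a /\
  exists g, g ∈ V /\ derivation V M a g /\
  exists k, k ∈ V /\ exists y, y ∈ car M /\ opair k y ∈ g /\
    (opair Om y ∈ lt_rel M \/ Om = y)) u).
{ destruct HI as [? [? [? [? [? ?]]]]].
  apply sep_in; [exact HV | unfold card, derivation, beta_rel; z_tac | exact Hu]. }
assert (C : forall A a, A ⊆ seg M Om -> a ∈ car M -> card A a <-> mcard M A a).
{ intros A a HA Ha; rewrite (mcard_iff M A a HM); unfold card; split.
  - intros [c [Hc [d [Hd [I R]]]]]; split; [exact Ha|].
    exists c; split; [exact Hc|]; exists d; split; [exact Hd|]; split.
    + intros x Hx x' Hx' y Hy L L' B B'; apply (I x Hx x' Hx' y Hy L L').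
      * apply beta_rel_iff; try assumption; apply HM.
      * apply beta_rel_iff; try assumption; apply HM.
    + intros y; split.
      * intros Hy; assert (Hy' := proj1 (proj1 (mem_seg _ _ _) (HA y Hy))).
        split; [exact Hy'|]; apply (R y Hy') in Hy as [x [Hx [L B]]].
        exists x; split; [exact Hx|]; split; [exact L|].
        apply beta_rel_iff in B; try assumption; apply HM.
      * intros [Hy [x [Hx [L B]]]]; apply (R y Hy).
        exists x; split; [exact Hx|]; split; [exact L|].
        apply beta_rel_iff; try assumption; apply HM.
  - intros [_ [c [Hc [d [Hd [I R]]]]]].
    exists c; split; [exact Hc|]; exists d; split; [exact Hd|]; split.
    + intros x Hx x' Hx' y Hy L L' B B'.
      apply beta_rel_iff in B, B'; try assumption; try apply HM.
      exact (I x Hx x' Hx' y Hy L L' B B').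
    + intros y Hy; rewrite R; split.
      * intros [_ [x [Hx [L B]]]]; exists x; split; [exact Hx|]; split; [exact L|].
        apply beta_rel_iff; try assumption; apply HM.
      * intros [x [Hx [L B]]]; split; [exact Hy|].
        exists x; split; [exact Hx|]; split; [exact L|].
        apply beta_rel_iff in B; try assumption; apply HM. }
clearbody card; apply set_ext; intros A.
rewrite mem_sep, (Aplus_iff M Om A HM HO H0), U; split.
- intros [[_ HA] [a [Ha [K [g [Hg [D [k [Hk [y [Hy [Hky L]]]]]]]]]]]].
  split; [exact HA|]; exists a; split; [apply C; assumption|].
  destruct (derivation_multiple V M a g (proj1 HV) (proj1 HM) D k Hk y Hy Hky) as [n ->].
  exists n; exact L.
- intros [HA [a [K [n L]]]]; assert (Ha := mcard_car _ _ _ K).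
  split; [split; [|exact HA]|].
  + apply (coded_set_in V M Om); try assumption; [apply HM|].
    apply (mcard_coded M A a); assumption.
  + exists a; split; [exact Ha|]; split; [apply C; assumption|].
    destruct (multiple_derivation V M a n HV (proj1 HM) HI Ha)
      as [g [Hg [D [k [Hk Hky]]]]].
    exists g; split; [exact Hg|]; split; [exact D|]; exists k; split; [exact Hk|].
    exists (nmul M n a); split; [apply nmul_car; [apply HM | exact Ha]|].
    split; [exact Hky | exact L].
Qed.

Lemma generic_not_in V M Om G : transitive_model V -> true_arithmetic M ->
  arith_in V M -> nonstandard M Om -> generic V (Aplus M Om) (le_star M Om) G -> G ∉ V.
Proof.
intros HV HM HI HN HG K; pose proof HN as [HO HN']; pose proof (HN' 0) as H0; simpl in H0.
pose proof (Aplus_in V M Om HV HM HI HO H0) as HP.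
destruct (gen_dense _ _ _ _ HG (setminus (Aplus M Om) G)) as [p [Hp Hp']].
- unfold setminus; apply (sep_in V (fun z => z ∈ G -> False)); [exact HV | | exact HP].
  apply zdef_not; z_tac.
- split; [intros p Hp; apply mem_setminus in Hp; apply Hp|].
  intros p Hp.
  destruct (Aplus_split M Om p HM HN Hp) as [A1 [A2 [P1 [P2 [S1 [S2 D]]]]]].
  (* If nothing below p lay outside [G], every positive subset of p would be in [G], in particular
     both halves. *)
  apply NNPP; intros N.
  assert (G1 : forall q, q ∈ Aplus M Om -> q ⊆ p -> q ∈ G).
  { intros q Hq Sq; apply NNPP; intros Nq; apply N; exists q.
    split; [apply mem_setminus; auto | apply le_star_subset; assumption]. }
  destruct (gen_directed _ _ _ _ HG A1 A2 (G1 A1 P1 S1) (G1 A2 P2 S2)) as [r [Hr [L1 L2]]].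
  apply (null_union M Om r (setminus r A1) (setminus r A2)); try assumption.
  { exact (gen_sub _ _ _ _ HG r Hr). }
  (* The halves are disjoint, so each point of r misses one of them. *)
  intros x Hx; rewrite !mem_setminus; destruct (classic (x ∈ A1)) as [X|X]; [right|left].
  + exact (conj Hx (D x X)).
  + exact (conj Hx X).
- apply mem_setminus in Hp' as [_ Hp']; exact (Hp' Hp).
Qed.

Theorem theorem5p13 (V : set) (M : arith) (Om G : set)
  (hV : ctm V) (hCH : CH_in V)
  (hMV : mem (arith_set M) V)
  (hTA : true_arithmetic M)
  (hns : nonstandard_model M)
  (hsat : omega1_saturated_in V M)
  (hcard : card_omega1_in V M)
  (hOm : nonstandard M Om)
  (hG : generic V (Aplus M Om) (le_star M Om) G) :
  (forall y : set,
     extension V (rv_class M Om G (id_rv M Om)) y <-> extension V G y) /\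
  (forall F : set,
     rv_collection M Om F ->
     mem (id_rv M Om) F ->
     mem (rv_class M Om G (id_rv M Om)) (car (rv_model M Om G F)) /\
     ~ mem (car (rv_model M Om G F)) V /\
     ~ mem (arith_set (rv_model M Om G F)) V).
Proof.
destruct hV as [hV _]; pose proof (proj1 hOm) as HO.
assert (HI : forall W, transitive_model W -> V ⊆ W -> arith_in W M).
{ intros W HW HVW; apply arith_set_in; [apply HW | apply HVW, hMV]. }
pose proof (gen_sub _ _ _ _ hG) as HG.
split.
- intros y; split; intros H W HW HVW K; apply H; try assumption.
  + apply rv_class_id_in; auto.
  + apply (generic_in W M Om); auto.
- intros F _ HF.
  assert (C : rv_class M Om G (id_rv M Om) ∈ car (rv_model M Om G F)).
  { apply mem_image; exists (id_rv M Om); auto. }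
  assert (N : car (rv_model M Om G F) ∉ V).
  { intros K; assert (HV : arith_in V M) by (apply HI; [exact hV | intros x; auto]).
    apply (generic_not_in V M Om G); try assumption.
    apply (generic_in V M Om); try assumption.
    exact (proj1 hV _ K _ C). }
  split; [exact C|]; split; [exact N|].
  intros K; apply N; exact (proj1 (opair_in_inv V _ _ (proj1 hV) K)).
Qed.
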